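(* Let $\mathbb{F}$ be an algebraically closed field of characteristic $0$. The approximative complexity classes $\overline{\mathrm{VF}}(n^{\log n})$, $\overline{\mathrm{VBP}}(n^{\log n})$ and $\overline{\mathrm{VNP}}(n^{\log n})$ are each closed under factors: if $\{f_n\}_n$ lies in one of these classes and $g_n$ is a polynomial factor of $f_n$ for each $n$, then $\{g_n\}_n$ lies in the same class.
   Context: For $s:\mathbb{N}\to\mathbb{N}$ and a field $K$: $\mathrm{VF}(s)$ (resp. $\mathrm{VBP}(s)$) over $K$ is the class of families $\{f_n\}$ of $n$-variate polynomials of degree $\mathrm{poly}(n)$ computable by algebraic formulas (resp. algebraic branching programs) of size $\mathrm{poly}(s(n))$ with constants from $K$; $\mathrm{VNP}(s)$ over $K$ is the class of families of degree $\mathrm{poly}(n)$ with $f_n(\overline{x})=\sum_{w\in\{0,1\}^{t(n)}}h_n(\overline{x},w)$ for a verifier $h_n$ computable by a circuit of size $\mathrm{poly}(s(n))$ and $t(n)=\mathrm{poly}(s(n))$. For such a class $C$, the approximative closure $\overline{C}$ over $\mathbb{F}$ consists of families $\{f_n\}$ of polynomials in $\mathbb{F}[\overline{x}]$ for which there exist polynomials $f_{n;i}\in\mathbb{F}[\overline{x}]$ and a function $t$ such that the family $g_n(\overline{x}) = f_n(\overline{x}) + \epsilon f_{n;1}(\overline{x}) + \cdots + \epsilon^{t(n)}f_{n;t(n)}(\overline{x})$ is in $C$ over the rational function field $\mathbb{F}(\epsilon)$, $\epsilon$ a formal variable.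
   Formalization: ''Polynomial factor'' is read as f_n = g_n·h_n with h_n nonzero (automatic when f_n ≠ 0), since otherwise every polynomial would be a factor of the zero polynomial and the claim would fail for f_n = 0 (e.g. g_n = x_1^{2^n}). *)

(* Defs.v *)
From HB Require Import structures.
From mathcomp Require Import all_boot all_order all_algebra.
From mathcomp Require Export mpoly.

Set Implicit Arguments.
Unset Strict Implicit.
Unset Printing Implicit Defensive.

Import GRing.Theory.
Local Open Scope ring_scope.

(** Families of polynomials: the [n]-th member is [n]-variate. *)
Definition poly_family (K : fieldType) := forall n : nat, {mpoly K[n]}.

(** [t n = poly (s n)] *)
Definition poly_in (s t : nat -> nat) : Prop :=
  exists c : nat, forall n, (t n <= s n ^ c + c)%N.

(** [msize] is the degree plus one, and [0] for the zero polynomial. *)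
Definition poly_degree (K : fieldType) (f : poly_family K) : Prop :=
  poly_in id (fun n => (msize (f n)).-1).

(** * Algebraic formulas *)

Inductive formula (K : fieldType) (n : nat) : Type :=
| FVar of 'I_n
| FConst of K
| FAdd of formula K n & formula K n
| FMul of formula K n & formula K n.

Fixpoint formula_size (K : fieldType) (n : nat) (e : formula K n) : nat :=
  match e with
  | FVar _ | FConst _ => 1%N
  | FAdd a b | FMul a b => (formula_size a + formula_size b).+1
  end.

Fixpoint formula_poly (K : fieldType) (n : nat) (e : formula K n)
    : {mpoly K[n]} :=
  match e with
  | FVar i => 'X_i
  | FConst c => c%:MP
  | FAdd a b => formula_poly a + formula_poly b
  | FMul a b => formula_poly a * formula_poly b
  end.

(** * Algebraic circuits *)

(** A circuit is a DAG given by its nodes in topological order: the arguments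
    of an operation gate are the positions of earlier nodes, and the last node
    is the output.  The size of a circuit is its number of nodes. *)
Inductive gate (K : fieldType) (n : nat) : Type :=
| GVar of 'I_n
| GConst of K
| GAdd of nat & nat
| GMul of nat & nat.

Definition circuit (K : fieldType) (n : nat) := seq (gate K n).

Definition gate_wf (K : fieldType) (n : nat) (k : nat) (g : gate K n) : bool :=
  match g with
  | GVar _ | GConst _ => true
  | GAdd i j | GMul i j => (i < k)%N && (j < k)%N
  end.

Definition circuit_wf (K : fieldType) (n : nat) (C : circuit K n) : bool :=
  (0 < size C)%N &&
  [forall k : 'I_(size C), gate_wf k (tnth (in_tuple C) k)].

Definition gate_poly (K : fieldType) (n : nat)
    (vs : seq {mpoly K[n]}) (g : gate K n) : {mpoly K[n]} :=
  match g with
  | GVar i => 'X_i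
  | GConst c => c%:MP
  | GAdd i j => vs`_i + vs`_j
  | GMul i j => vs`_i * vs`_j
  end.

Definition circuit_polys (K : fieldType) (n : nat) (C : circuit K n)
    : seq {mpoly K[n]} :=
  foldl (fun vs g => rcons vs (gate_poly vs g)) [::] C.

Definition circuit_poly (K : fieldType) (n : nat) (C : circuit K n)
    : {mpoly K[n]} :=
  last 0 (circuit_polys C).

(** * Algebraic branching programs *)

Record abp (K : fieldType) (n : nat) : Type := ABP {
  abp_size : nat;  (* number of vertices *)
  abp_depth : nat;
  abp_layer : 'I_abp_size -> nat;
  abp_edge : rel 'I_abp_size;
  abp_label : 'I_abp_size -> 'I_abp_size -> {mpoly K[n]};
  abp_source : 'I_abp_size;
  abp_sink : 'I_abp_size
}.

(** Edges join consecutive layers and carry affine linear polynomials; the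
    source and the sink are the only vertices of the first and last layers. *)
Definition abp_wf (K : fieldType) (n : nat) (A : abp K n) : Prop :=
  [/\ forall u : 'I_(abp_size A), (abp_layer u <= abp_depth A)%N,
      forall u : 'I_(abp_size A), abp_layer u = 0%N <-> u = abp_source A,
      forall u : 'I_(abp_size A),
        abp_layer u = abp_depth A <-> u = abp_sink A
    & forall u v : 'I_(abp_size A), abp_edge u v ->
        abp_layer v = (abp_layer u).+1 /\ (msize (abp_label u v) <= 2)%N].

(** Sum over the source-sink paths of the product of the edge labels; all these
    paths have [abp_depth A] edges. *)
Definition abp_poly (K : fieldType) (n : nat) (A : abp K n) : {mpoly K[n]} :=
  \sum_(p : (abp_depth A).-tuple 'I_(abp_size A) |
        path (@abp_edge K n A) (abp_source A) p
        && (last (abp_source A) p == abp_sink A))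
    \prod_(l <- pairmap (@abp_label K n A) (abp_source A) p) l.

(** * Complexity classes *)

Definition pclass := forall K : fieldType, poly_family K -> Prop.

Definition VF (s : nat -> nat) : pclass := fun K f =>
  poly_degree f /\
  exists2 e : forall n, formula K n,
    poly_in s (fun n => formula_size (e n)) &
    forall n, formula_poly (e n) = f n.

Definition VBP (s : nat -> nat) : pclass := fun K f =>
  poly_degree f /\
  exists A : forall n, abp K n,
    [/\ forall n, abp_wf (A n),
        poly_in s (fun n => abp_size (A n))
      & forall n, abp_poly (A n) = f n].

(** [h(x, w)] for a 0/1 vector [w] *)
Definition subst_bits (K : fieldType) (n t : nat) (h : {mpoly K[n + t]})
    (w : t.-tuple bool) : {mpoly K[n]} :=
  h \mPo [tuple match split i with
                | inl j => 'X_j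
                | inr j => ((tnth w j)%:R)%:MP
                end | i < n + t].

Definition VNP (s : nat -> nat) : pclass := fun K f =>
  poly_degree f /\
  exists (t : nat -> nat) (C : forall n, circuit K (n + t n)),
    [/\ poly_in s t,
        forall n, circuit_wf (C n),
        poly_in s (fun n => size (C n))
      & forall n, f n =
          \sum_(w : (t n).-tuple bool) subst_bits (circuit_poly (C n)) w].

(** * Approximative closure *)

(** The field F(epsilon) of rational functions *)
Definition ratfun (F : fieldType) : fieldType := {fraction {poly F}}.

Definition ratfun_const (F : fieldType) (a : F) : ratfun F := tofrac (a%:P).

Definition epsilon (F : fieldType) : ratfun F := tofrac ('X : {poly F}).

Definition approx_closure (C : pclass) (F : fieldType) (f : poly_family F)
    : Prop :=
  exists (t : nat -> nat) (fi : forall n : nat, nat -> {mpoly F[n]}),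
    C (ratfun F) (fun n =>
      map_mpoly (@ratfun_const F) (f n) +
      \sum_(1 <= i < (t n).+1)
        epsilon F ^+ i *: map_mpoly (@ratfun_const F) (fi n i)).

(** * Closure under factors *)

(** The cofactor is required to be nonzero, so that an arbitrary polynomial does
    not count as a factor of the zero polynomial (for [f != 0] this is
    automatic). *)
Definition factor_of (K : fieldType) (n : nat) (g f : {mpoly K[n]}) : Prop :=
  exists2 h : {mpoly K[n]}, h != 0 & f = g * h.

Definition closed_under_factors (F : fieldType) (P : poly_family F -> Prop)
    : Prop :=
  forall f g : poly_family F,
    P f -> (forall n, factor_of (g n) (f n)) -> P g.

(** The function n^(log n), with the base-2 logarithm rounded down; the
    rounding and the base do not affect which functions are poly(n^(log n)). *)
Definition n_pow_log_n (n : nat) : nat := (n ^ trunc_log 2 n)%N.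

(* Main.v *)
Require Import Defs.
From HB Require Import structures.
From Stdlib Require Import IndefiniteDescription.
From mathcomp Require Import all_boot all_order all_algebra.
From mathcomp Require Import ring zify.

(** Let [f = g h] have degree at most [d], and let [P(t, y) = f(b + t x + y a)]
    with [a] such that [P] is monic in [y] up to a constant and [b] a generic
    point.  Over [F[[t]]] the factors of a coprime base of [g] and [h] stay
    pairwise coprime at [t = 0], so the partial fraction decomposition of
    [log (P / P(0, y))] with respect to [P(0, y)] separates their logarithms.
    Weighting each part by the quotient of its multiplicities in [g] and [f]
    (characteristic 0) and evaluating at [y = 0] gives [log (g(b + t x) / g(b))],
    from which a truncated exponential recovers [g].  The weighted projection is
    a linear functional on polynomials in [y] with coefficients in [F], and
    linear functionals on polynomials of bounded degree are sums of samples;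
    hence [g] is an expression of size [poly d] in substitutions
    [f(s x + beta)], with constants of [F].  Applied to a polynomial over
    [F[eps]] that reduces to [f] at [eps = 0], the same expression gives one
    that reduces to [g]. *)

Set Implicit Arguments.
Unset Strict Implicit.
Unset Printing Implicit Defensive.

Import GRing.Theory.
Local Open Scope ring_scope.

(** * Congruence modulo powers of the variable *)

(** The approximating polynomial over [F(eps)] may be irreducible, and constants of [F(eps)] may
    have poles at [eps = 0]. So nothing is factored there: points, weights and interpolation
    constants are chosen over [F] for [f] itself, and the resulting expression is only re-evaluated.
    It then stays over [F[eps]], and its evaluation commutes with [eps = 0].

    Hensel lifting of [f = g h] would need [g] and [h] coprime. Here both factors exist beforehand
    and are only specialized. Base elements may be reducible or powers: one of multiplicity [m] in
    [f] and [e] in [g] just receives the weight [e / m].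

    Series are truncated at order [d + 1], which determines [g] on a line. Clearing the denominator
    [P(0, y)^(d+1)] keeps all coefficients polynomial in [y].

    The expression consists of constants, sums, products and substitutions, nested to a bounded
    number of levels. Formulas, branching programs and exponential sums each allow these operations
    at additive or linear cost, so one transfer argument serves the three classes. *)

Section TruncatedCongruence.
Variable R : comNzRingType.
Implicit Types (p q r : {poly R}) (k n : nat).

Definition tcong k p q := exists r, p = q + r * 'X^k.

Lemma tcong_refl k p : tcong k p p.
Proof. by exists 0; rewrite mul0r addr0. Qed.

Lemma tcong_sym k p q : tcong k p q -> tcong k q p.
Proof. by case=> r ->; exists (- r); ring. Qed.

Lemma tcong_trans k q p r : tcong k p q -> tcong k q r -> tcong k p r.
Proof. by case=> a -> [b ->]; exists (a + b); ring. Qed.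

Lemma tcongD k p q p' q' :
  tcong k p q -> tcong k p' q' -> tcong k (p + p') (q + q').
Proof. by case=> a -> [b ->]; exists (a + b); ring. Qed.

Lemma tcongM k p q p' q' :
  tcong k p q -> tcong k p' q' -> tcong k (p * p') (q * q').
Proof.
by case=> a -> [b ->]; exists (a * q' + q * b + a * b * 'X^k); ring.
Qed.

Lemma tcong_sum k (I : Type) (s : seq I) (A B : I -> {poly R}) :
  (forall i, tcong k (A i) (B i)) ->
  tcong k (\sum_(i <- s) A i) (\sum_(i <- s) B i).
Proof.
move=> AB; apply: (big_ind2 (tcong k)) => [|p q p' q'|i _] //.
- exact: tcong_refl.
- exact: tcongD.
Qed.

Lemma tcong_prod k (I : Type) (s : seq I) (A B : I -> {poly R}) :
  (forall i, tcong k (A i) (B i)) ->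
  tcong k (\prod_(i <- s) A i) (\prod_(i <- s) B i).
Proof.
move=> AB; apply: (big_ind2 (tcong k)) => [|p q p' q'|i _] //.
- exact: tcong_refl.
- exact: tcongM.
Qed.

Lemma tcongX k p q n : tcong k p q -> tcong k (p ^+ n) (q ^+ n).
Proof.
move=> pq; elim: n => [|n IHn]; first exact: tcong_refl.
by rewrite !exprS; apply: tcongM.
Qed.

Lemma tcong_leq k n p q : (n <= k)%N -> tcong k p q -> tcong n p q.
Proof.
move=> le_nk [r ->]; exists (r * 'X^(k - n)).
by rewrite -mulrA -exprD subnK.
Qed.

Lemma tcongP k p q : tcong k p q <-> (forall i, (i < k)%N -> p`_i = q`_i).
Proof.
split=> [[r ->] i lt_ik|pq].
  by rewrite coefD coefMXn lt_ik addr0.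
exists (drop_poly k (p - q)).
rewrite -[p in LHS](subrK q) addrC -[in LHS](poly_take_drop k (p - q)).
suff -> : take_poly k (p - q) = 0 by rewrite add0r.
apply/polyP=> i; rewrite coef_take_poly coef0.
by case: ifP => // lt_ik; rewrite coefB pq // subrr.
Qed.

Lemma tcong_deriv k p q : tcong k.+1 p q -> tcong k p^`() q^`().
Proof.
case=> r ->; exists (r^`() * 'X + r *+ k.+1).
rewrite derivD derivM derivXn /= exprS mulrnAr -mulrnAl; ring.
Qed.

Lemma tcong_take k p : tcong k (take_poly k p) p.
Proof. by apply/tcongP=> i lt_ik; rewrite coef_take_poly lt_ik. Qed.

End TruncatedCongruence.

Lemma tcong_map (R S : comNzRingType) (f : {rmorphism R -> S}) k (p q : {poly R}) :
  tcong k p q -> tcong k (map_poly f p) (map_poly f q).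
Proof.
case=> r ->; exists (map_poly f r).
by rewrite rmorphD rmorphM /= map_polyXn.
Qed.


(** Coefficient [i] of a product is the constant coefficient of [p] times coefficient [i] of the
    other factor, plus terms in its lower coefficients. Induction on [i] thus only cancels a nonzero
    element of a domain. It is applied with coefficients in [F[y]], where [P(0, y)] has no inverse
    in general. *)
Lemma tcong_cancel (R : idomainType) k (p a b : {poly R}) :
  p`_0 != 0 -> tcong k (p * a) (p * b) -> tcong k a b.
Proof.
move=> p0 /tcongP pab; apply/tcongP; elim/ltn_ind=> i IH lt_ik.
have := pab i lt_ik; rewrite !coefM !big_ord_recl !subn0 /=.
have -> : \sum_(j < i) p`_(bump 0 j) * a`_(i - bump 0 j) =
          \sum_(j < i) p`_(bump 0 j) * b`_(i - bump 0 j).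
  apply: eq_bigr => j _; rewrite IH //; rewrite /bump /=; have := ltn_ord j; lia.
by move/addIr/(mulfI p0).
Qed.

(** * Logarithmic derivatives with a common denominator *)

Section LogDerivative.
Variables (R : comNzRingType) (N : {poly R}) (k : nat).
Implicit Types p q : {poly R}.

(** Here [q] stands for [N p' / p] modulo [X^k]; carrying the denominator [N] along avoids division
    in [R]. *)
Definition logder p q := tcong k (N * p^`()) (q * p).

Lemma logderC c : logder c%:P 0.
Proof. by rewrite /logder derivC mulr0 mul0r; apply: tcong_refl. Qed.

Lemma logderM p p' q q' :
  logder p q -> logder p' q' -> logder (p * p') (q + q').
Proof.
move=> lp lp'; rewrite /logder derivM.
have -> : N * (p^`() * p' + p * p'^`()) = N * p^`() * p' + N * p'^`() * p by ring.
have -> : (q + q') * (p * p') = q * p * p' + q' * p' * p by ring.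
by apply: tcongD; apply: tcongM => //; apply: tcong_refl.
Qed.

Lemma logderX p q n : logder p q -> logder (p ^+ n) (q *+ n).
Proof.
move=> lp; elim: n => [|n IHn]; first exact: logderC.
by rewrite exprS mulrS; apply: logderM.
Qed.

Lemma logder_prod (I : Type) (s : seq I) (A B : I -> {poly R}) :
  (forall i, logder (A i) (B i)) ->
  logder (\prod_(i <- s) A i) (\sum_(i <- s) B i).
Proof.
move=> AB; elim: s => [|i s IHs]; first by rewrite !big_nil; apply: logderC.
by rewrite !big_cons; apply: logderM.
Qed.

Lemma logder_tcong p p' q : tcong k.+1 p' p -> logder p q -> logder p' q.
Proof.
move=> pp' lp; have dp := tcong_deriv pp'.
apply: tcong_trans (tcongM (tcong_refl k N) dp) _; apply: tcong_trans lp _.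
apply: tcongM; first exact: tcong_refl.
by apply: tcong_sym; apply: tcong_leq pp'.
Qed.

End LogDerivative.

Lemma logder_unique (R : idomainType) (N : {poly R}) k (p q q' : {poly R}) :
  p`_0 != 0 -> logder N k p q -> logder N k p q' -> tcong k q q'.
Proof.
move=> p0 lq lq'; apply: (tcong_cancel p0); rewrite ![p * _]mulrC.
exact: tcong_trans (tcong_sym lq) lq'.
Qed.

Section TruncatedInverse.
Variable R : comNzRingType.
Implicit Types p : {poly R}.

(* [p * truncinv K p] agrees with [p`_0 ^+ K] up to order [K]: a geometric sum. *)
Definition truncinv K p : {poly R} :=
  \sum_(i < K) (p`_0)%:P ^+ (K.-1 - i) * ((p`_0)%:P - p) ^+ i.

Lemma subr_coef0E p : exists r, (p`_0)%:P - p = r * 'X.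
Proof.
have [|r ->] := (tcongP 1 ((p`_0)%:P - p) 0).2.
  by case=> // _; rewrite coefB coefC coef0 subrr.
by exists r; rewrite add0r expr1.
Qed.

Lemma tcong_truncinv K p : tcong K (p * truncinv K p) ((p`_0 ^+ K)%:P).
Proof.
have [r Er] := subr_coef0E p.
have := subrXX (p`_0)%:P ((p`_0)%:P - p) K; rewrite subKr => E.
rewrite /truncinv -E Er exprMn rmorphXn /=; exists (- r ^+ K); ring.
Qed.

(** The natural denominator of the truncated [p' / p] is the [K]-th power of the constant
    coefficient of [p]; the cofactor [C] raises it to a denominator [N] shared by all factors. *)
Lemma logder_truncinv K p (N : R) C : N = p`_0 ^+ K * C ->
  logder N%:P K p (p^`() * truncinv K p * C%:P).
Proof.
move=> ->; rewrite /logder.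
have -> : p^`() * truncinv K p * C%:P * p = p * truncinv K p * (C%:P * p^`()).
  by ring.
rewrite rmorphM /= -mulrA; apply: tcongM; last exact: tcong_refl.
by apply: tcong_sym; apply: tcong_truncinv.
Qed.

End TruncatedInverse.

(** * Truncated exponentials *)

Section Exponential.
Variable F : fieldType.
Hypothesis charF : [pchar F] =i pred0.
Implicit Types p L : {poly F}.

Lemma natr_neq0 n : (n.+1%:R : F) != 0.
Proof. by rewrite (pcharf0P F).1. Qed.

Definition texp K L : {poly F} := \sum_(i < K) (i`!%:R)^-1 *: L ^+ i.

Lemma deriv_texp K L : (texp K.+1 L)^`() = L^`() * texp K L.
Proof.
rewrite /texp raddf_sum /= big_ord_recl expr0 derivZ derivC scaler0 add0r.
rewrite mulr_sumr; apply: eq_bigr => i _ /=.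
rewrite derivZ deriv_exp /= /bump /= add1n -scalerAr -scalerMnr scalerMnl.
congr (_ *: _); rewrite factS natrM invfM -mulr_natr mulrAC mulVf ?mul1r //.
exact: natr_neq0.
Qed.

Lemma texp_coef0 K L : L`_0 = 0 -> (texp K.+1 L)`_0 = 1.
Proof.
move=> L0; rewrite /texp coef_sum big_ord_recl expr0 coefZ coefC /= fact0.
rewrite invr1 mul1r big1 ?addr0 // => i _.
by rewrite -horner_coef0 hornerZ horner_exp horner_coef0 L0 exprS mul0r mulr0.
Qed.

(** Both sides solve the linear differential equation [D' = L' D] up to order [K] with the same
    initial value, and in characteristic 0 the solution is unique. *)
Lemma tcong_texp K p L : L`_0 = 0 -> tcong K (L^`() * p) p^`() ->
  tcong K.+1 p ((p`_0)%:P * texp K.+1 L).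
Proof.
move=> L0 Lp; set E := texp K.+1 L.
(* [E] exceeds the sum occurring in its own derivative by the term [L^K / K!], which is divisible by
   [X^K] because [L] has no constant term. *)
have LE : tcong K (L^`() * E) E^`().
  rewrite deriv_texp; apply: tcongM; first exact: tcong_refl.
  have [r Er] : exists r, L = r * 'X.
    have [r Er] := subr_coef0E L; rewrite L0 sub0r in Er.
    by exists (- r); rewrite mulNr -Er opprK.
  rewrite /E /texp big_ord_recr /= -/(texp K L) {2}Er exprMn.
  by exists ((K`!%:R)^-1 *: r ^+ K); rewrite scalerAl.
set D := p - (p`_0)%:P * E.
have D0 : D`_0 = 0 by rewrite coefB coefCM texp_coef0 // mulr1 subrr.
have LD : tcong K D^`() (L^`() * D).
  apply: tcong_sym; case: Lp => r Er; case: LE => s Es; exists (r - (p`_0)%:P * s).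
  by rewrite /D derivB derivM derivC mulrBr Er mulrCA Es; ring.
have [|r Er] := (tcongP K.+1 D 0).2; last first.
  by exists r; rewrite -[LHS](subrK ((p`_0)%:P * E)) -/D Er; ring.
(* Coefficient [i] of [D'] is [i + 1] times coefficient [i + 1] of [D], while that of [L' D]
   involves only coefficients of [D] up to [i], already known to vanish. *)
elim/ltn_ind=> -[|i] IH lt_iK; first by rewrite D0 coef0.
move/tcongP: LD => /(_ i lt_iK); rewrite coef_deriv coefM big1.
  move/eqP; rewrite -mulr_natr mulf_eq0 (negPf (natr_neq0 i)) orbF coef0.
  by move/eqP.
move=> j _; rewrite [D`_ _]IH ?coef0 ?mulr0 //; have := ltn_ord j; lia.
Qed.

End Exponential.

(** * Linear functionals as sampling *)

Section Sampling.
Variable F : fieldType.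
Hypothesis charF : [pchar F] =i pred0.

Lemma natr_inj : injective (fun n : nat => n%:R : F).
Proof.
move=> i j; wlog le_ij : i j / (i <= j)%N => [th|].
  by case: (leqP i j) => [/th//|/ltnW /th h /esym/h].
move/eqP; rewrite eq_sym -subr_eq0 -natrB // (pcharf0P F).1 //.
by rewrite subn_eq0 => le_ji; apply/eqP; rewrite eqn_leq le_ij.
Qed.

(** Lagrange interpolation at [0, ..., M - 1], which are distinct in characteristic 0: [c l] is the
    value of [phi] on the [l]-th Lagrange polynomial. *)
Lemma sampling_functional M (phi : {poly F} -> F) :
  (forall a b, phi (a + b) = phi a + phi b) ->
  (forall k a, phi (k *: a) = k * phi a) ->
  exists c : nat -> F, forall a : {poly F}, (size a <= M)%N ->
    phi a = \sum_(l < M) c l * a.[l%:R].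
Proof.
move=> phiD phiZ; case: M => [|M].
  exists (fun=> 0) => a; rewrite leqn0 size_poly_eq0 => /eqP ->.
  by rewrite big_ord0 -(scale0r 0) phiZ mul0r.
have phi_sum (I : Type) (s : seq I) (A : I -> {poly F}) :
    phi (\sum_(i <- s) A i) = \sum_(i <- s) phi (A i).
  elim: s => [|i s IHs]; last by rewrite !big_cons phiD IHs.
  by rewrite !big_nil -(scale0r 0) phiZ mul0r.
pose x n := n%:R : F.
exists (fun l => phi (tnth (lagrange M.+1 x) (inord l))) => a sa.
rewrite {1}(lagrange_gen (n := M.+1) (x := x) _ natr_inj sa) // phi_sum.
by apply: eq_bigr => l _; rewrite mul_polyC phiZ inord_val mulrC.
Qed.

(* The functional reads the part of [a / prod_j w_j^(K m_j)] whose poles are the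
   zeros of [w_i] at the point 0. *)
Lemma partial_fraction_functional r (w : 'I_r -> {poly F}) (m : 'I_r -> nat)
    (K : nat) (c : F) (i : 'I_r) :
  c != 0 -> (0 < m i)%N -> (w i).[0] != 0 ->
  (forall j, j != i -> coprimep (w i) (w j)) ->
  exists phi : {poly F} -> F,
    [/\ forall a b, phi (a + b) = phi a + phi b,
        forall k a, phi (k *: a) = k * phi a,
        forall A : {poly F}, (size A < size (w i ^+ K))%N ->
          phi (A * (w i ^+ (K * (m i).-1) * (c *: \prod_(j | j != i) w j ^+ (K * m j))))
          = A.[0] / (w i).[0] ^+ K
      & forall a, phi (w i ^+ (K * m i) * a) = 0].
Proof.
move=> c0 mi wi0 cop.
set Q := c *: _; set N := w i ^+ (K * m i).
have copQ : coprimep N Q.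
  rewrite /Q coprimepZr //; apply: coprimep_expl.
  elim/big_rec: _ => [|j p ji IH]; first exact: coprimep1.
  by rewrite coprimepMr IH andbT; apply: coprimep_expr; apply: cop.
have /Bezout_eq1_coprimepP [[B' B] /= EB] := copQ.
have N0 : N.[0] != 0 by rewrite horner_exp expf_neq0.
have Nn0 : N != 0 by apply: contraNneq N0 => ->; rewrite horner0.
(* Since [B' N + B Q = 1], the part of [a / (N Q)] with denominator [N] is the remainder of [a B]
   modulo [N], divided by [N]. *)
exists (fun a => ((a * B) %% N).[0] / N.[0]); split=> [a b|k a|A sA|a].
- by rewrite mulrDl modpD hornerD mulrDl.
- by rewrite -scalerAl modpZl hornerZ mulrA.
- have -> : A * (w i ^+ (K * (m i).-1) * Q) * B =
      A * w i ^+ (K * (m i).-1) - (A * w i ^+ (K * (m i).-1) * B') * N.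
    have EQ : B * Q = 1 - B' * N by rewrite -EB; ring.
    have -> : A * (w i ^+ (K * (m i).-1) * Q) * B =
              A * w i ^+ (K * (m i).-1) * (B * Q) by ring.
    by rewrite EQ; ring.
  have E : N = w i ^+ K * w i ^+ (K * (m i).-1).
    by rewrite -exprD -{1}[K]muln1 -mulnDr add1n prednK.
  rewrite modpD modpN modp_mull subr0 modp_small; last first.
    have wn0 : w i != 0 by apply: contraNneq wi0 => ->; rewrite horner0.
    rewrite E; have [->|An0] := eqVneq A 0.
      by rewrite mul0r size_poly0 size_poly_gt0 mulf_neq0 // expf_neq0.
    rewrite !size_mul ?expf_neq0 //.
    have : (0 < size (w i ^+ (K * (m i).-1)))%N by rewrite size_poly_gt0 expf_neq0.
    move: sA; move: (size A) (size (w i ^+ K)) (size (w i ^+ (K * (m i).-1))); lia.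
  rewrite E !hornerM !horner_exp -mulf_div divff ?mulr1 //.
  by rewrite expf_neq0.
- by rewrite -mulrA modp_mulr horner0 mul0r.
Qed.

End Sampling.

(** * The logarithmic derivative of a factor by sampling; the outer variable is [t], the inner one
    [y] *)

Section FactorLogDerivative.
Variable F : fieldType.
Hypothesis charF : [pchar F] =i pred0.
Variables (r : nat) (u : 'I_r -> {poly {poly F}}) (m e : 'I_r -> nat).
Variables (c cg : F) (K : nat) (P G : {poly {poly F}}).
Hypothesis c_neq0 : c != 0.
Hypothesis m_gt0 : forall i, (0 < m i)%N.

Let w i := (u i)`_0.
Let D i := w i ^+ K.+1.
Let C i := w i ^+ (K.+1 * (m i).-1) *
  (c ^+ K.+1 *: \prod_(j | j != i) w j ^+ (K.+1 * m j)).

Hypothesis u_proper : forall i k, (0 < k)%N -> (size ((u i)`_k)%R < size (w i))%N.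
Hypothesis w_neq0 : forall i, (w i).[0] != 0.
Hypothesis P_factors : tcong K.+1 P (c%:P%:P * \prod_i u i ^+ m i).
Hypothesis G_factors : tcong K.+1 G (cg%:P%:P * \prod_i u i ^+ e i).

Lemma coef0_factors : P`_0 = c *: \prod_i w i ^+ m i.
Proof.
have -> : P`_0 = (c%:P%:P * \prod_i u i ^+ m i)`_0.
  by move/tcongP: P_factors => ->.
rewrite -!horner_coef0 hornerM hornerC horner_prod mul_polyC.
by congr (_ *: _); apply: eq_bigr => i _; rewrite horner_exp horner_coef0.
Qed.

Lemma coef0_factorsX i : P`_0 ^+ K.+1 = D i * C i.
Proof.
rewrite coef0_factors exprZn (bigD1 i) //= exprMn /C /D -prodrXl.
under eq_bigr => j _ do rewrite -exprM mulnC.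
rewrite -!scalerAr mulrA -exprD -exprM; congr (_ *: (_ ^+ _ * _)).
  by rewrite -{2}[K.+1]muln1 -mulnDr add1n prednK // mulnC.
Qed.

Let ydeg n (q : {poly {poly F}}) := forall k, (size (q`_k)%R <= n.+1)%N.

Let ydegM n n' q q' : ydeg n q -> ydeg n' q' -> ydeg (n + n') (q * q').
Proof.
move=> hq hq' k; rewrite coefM; apply: (big_ind (fun a : {poly F} => size a <= (n + n').+1)%N).
- by rewrite size_poly0.
- by move=> a b ha hb; apply: leq_trans (size_polyD _ _) _; rewrite geq_max ha.
move=> j _; apply: leq_trans (size_polyMleq _ _) _.
by have := hq j; have := hq' (k - j)%N; lia.
Qed.

Let ydegX n q j : ydeg n q -> ydeg (n * j) (q ^+ j).
Proof.
move=> hq; elim: j => [|j IHj].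
  by move=> k; rewrite expr0 coef1 muln0; case: (k == 0)%N; rewrite ?size_poly1 ?size_poly0.
by rewrite exprS mulnS; apply: ydegM.
Qed.

(** Let [d] be the degree of [w i]. Every summand of [truncinv] is a product of [K] factors of
    [y]-degree at most [d], and by [u_proper] the derivative in [t] has [y]-degree below [d]. The
    total stays below [d (K + 1)], so the quotient by [D i] is a proper fraction in [y], as the
    partial fraction functional requires. *)
Lemma size_coef_logder i k :
  (size (((u i)^`() * truncinv K.+1 (u i))`_k)%R < size (D i))%N.
Proof.
have wn0 : w i != 0 by apply: contraNneq (w_neq0 i) => ->; rewrite horner0.
have [d Ed] : exists d, size (w i) = d.+1.
  by exists (size (w i)).-1; rewrite prednK // size_poly_gt0.
have dD : size (D i) = (d * K.+1).+1.
  by rewrite -[d]/(d.+1.-1) -Ed -size_exp prednK // size_poly_gt0 expf_neq0.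
have hu : ydeg d ((w i)%:P - u i).
  move=> [|j]; rewrite coefB coefC /=; first by rewrite subrr size_poly0.
  by rewrite sub0r size_polyN -Ed ltnW // u_proper.
have hw : ydeg d (w i)%:P.
  by move=> j; rewrite coefC; case: (j == 0)%N; rewrite ?size_poly0 ?Ed.
have ht : ydeg (d * K) (truncinv K.+1 (u i)).
  move=> j; rewrite /truncinv coef_sum.
  apply: (big_ind (fun a : {poly F} => size a <= (d * K).+1)%N).
  - by rewrite size_poly0.
  - by move=> a b ha hb; apply: leq_trans (size_polyD _ _) _; rewrite geq_max ha.
  move=> l _; have -> : (d * K = d * (K - l) + d * l)%N.
    by rewrite -mulnDr subnK // -ltnS.
  by apply: ydegM; apply: ydegX.
(* For [d = 0], properness forces the derivative itself to be zero. *)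
rewrite coefM dD ltnS; case: d Ed dD hu hw ht => [|d] Ed dD hu hw ht.
  rewrite big1 ?size_poly0 // => j _; have := u_proper i (ltn0Sn j).
  by rewrite coef_deriv Ed ltnS leqn0 size_poly_eq0 => /eqP ->; rewrite mul0rn mul0r.
apply: (big_ind (fun a : {poly F} => size a <= d.+1 * K.+1)%N).
- by rewrite size_poly0.
- by move=> a b ha hb; apply: leq_trans (size_polyD _ _) _; rewrite geq_max ha.
move=> j _; apply: leq_trans (size_polyMleq _ _) _.
have := ht (k - j)%N; have := u_proper i (ltn0Sn j); rewrite Ed coef_deriv.
have : (size ((u i)`_j.+1 *+ j.+1)%R <= size ((u i)`_j.+1)%R)%N.
  by rewrite -scaler_nat size_scale_leq.
move: (size _) (size _) (size _) => x y z; nia.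
Qed.

Variables (M : nat) (cl : nat -> F).

Definition sample (q : {poly {poly F}}) : {poly F} :=
  \sum_(l < M) cl l *: map_poly (horner_eval l%:R) q.

Lemma coef_sample q k : (sample q)`_k = \sum_(l < M) cl l * (q`_k).[l%:R].
Proof.
rewrite /sample coef_sum; apply: eq_bigr => l _.
by rewrite coefZ coef_map.
Qed.

Lemma sampleD p q : sample (p + q) = sample p + sample q.
Proof.
by rewrite /sample -big_split; apply: eq_bigr => l _; rewrite rmorphD scalerDr.
Qed.

Lemma sample_sum (I : Type) (s : seq I) (A : I -> {poly {poly F}}) :
  sample (\sum_(i <- s) A i) = \sum_(i <- s) sample (A i).
Proof.
elim: s => [|i s IHs]; last by rewrite !big_cons sampleD IHs.
by rewrite !big_nil /sample big1 // => l _; rewrite rmorph0 scaler0.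
Qed.

Lemma sampleMn p n : sample (p *+ n) = sample p *+ n.
Proof.
elim: n => [|n IHn]; last by rewrite !mulrS sampleD IHn.
by rewrite !mulr0n /sample big1 // => l _; rewrite rmorph0 scaler0.
Qed.

Lemma tcong_sample k p q : tcong k p q -> tcong k (sample p) (sample q).
Proof.
move/tcongP => pq; apply/tcongP => i lt_ik; rewrite !coef_sample.
by apply: eq_bigr => l _; rewrite pq.
Qed.

Hypothesis sample_factor : forall i (A : {poly F}), (size A < size (D i))%N ->
  \sum_(l < M) cl l * (A * C i).[l%:R] =
  (e i)%:R / (m i)%:R * (A.[0] / (D i).[0]).

(** [N P' / P] has two expressions, one from [truncinv] and one as the sum of the [m i] times the
    contributions of the [u i]; by uniqueness they agree to order [K]. Sampling the second turns
    each weight [m i] into [e i] and sets [y = 0], which leaves the logarithmic derivative of [G] at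
    [y = 0]. *)
Lemma logder_factor :
  tcong K (sample (P^`() * truncinv K.+1 P) * map_poly (horner_eval 0) G)
          (map_poly (horner_eval 0) G)^`().
Proof.
pose N := P`_0 ^+ K.+1.
pose q i := (u i)^`() * truncinv K.+1 (u i).
have w0 i : w i != 0 by apply: contraNneq (w_neq0 i) => ->; rewrite horner0.
have P0 : P`_0 != 0.
  rewrite coef0_factors scaler_eq0 negb_or c_neq0 prodf_seq_neq0.
  by apply/allP => i _; rewrite expf_neq0.
have lu i : logder N%:P K (u i) (q i * (C i)%:P).
  by apply: tcong_leq (logder_truncinv _) => //; apply: coef0_factorsX.
have lP1 : logder N%:P K P (P^`() * truncinv K.+1 P).
  apply: (tcong_leq (leqnSn K)); rewrite -[_ * truncinv _ _]mulr1.
  by apply: (logder_truncinv (C := 1)); rewrite mulr1.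
have lP2 : logder N%:P K P (\sum_i (q i * (C i)%:P) *+ m i).
  apply: logder_tcong P_factors _; rewrite -[\sum_i _]add0r.
  apply: logderM; first exact: logderC.
  by apply: logder_prod => i; apply: logderX.
have E : tcong K (sample (P^`() * truncinv K.+1 P))
    (\sum_i ((((D i).[0])^-1)%:P * map_poly (horner_eval 0) (q i)) *+ e i).
  apply: tcong_trans (tcong_sample (logder_unique P0 lP1 lP2)) _.
  rewrite sample_sum; apply: tcong_sum => i; rewrite sampleMn.
  apply/tcongP => k _; rewrite !coefMn coef_sample coefCM coef_map /=.
  under eq_bigr => l _ do rewrite coefMC.
  rewrite sample_factor ?size_coef_logder //.
  (* The multiplicity of [u i] in [P] cancels the denominator of the weight [e i / m i]; this takes
     characteristic 0. *)
  have mi : (m i)%:R != 0 :> F.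
    by rewrite (pcharf0P F).1 // -lt0n.
  by rewrite -[LHS]mulr_natr -[RHS]mulr_natr /horner_eval mulrAC divfK // mulrC [_ / _]mulrC.
have lG : logder 1 K (map_poly (horner_eval 0) G)
    (\sum_i ((((D i).[0])^-1)%:P * map_poly (horner_eval 0) (q i)) *+ e i).
  apply: (logder_tcong (tcong_map _ G_factors)); rewrite rmorphM rmorph_prod /=.
  rewrite -[\sum_i _]add0r; apply: logderM.
    by rewrite map_polyC /=; apply: logderC.
  apply: logder_prod => i; rewrite rmorphXn /=; apply: logderX.
  have [s Es] := tcong_map (horner_eval (0 : F))
    (logder_truncinv (K := K.+1) (p := u i) (esym (mulr1 _))).
  have Di0 : (D i).[0] != 0 by rewrite /D horner_exp expf_neq0 ?w_neq0.
  apply: (tcong_leq (leqnSn K)).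
  exists (((D i).[0])^-1%:P * s); move: Es.
  rewrite polyC1 !mulr1 [in LHS]rmorphM /= map_polyC /= -!deriv_map => Es.
  rewrite mul1r; transitivity (((D i).[0])^-1%:P *
    (((D i).[0])%:P * (map_poly (horner_eval 0) (u i))^`())).
    by rewrite mulrA -polyCM mulVf // mul1r.
  by rewrite Es -/(q i) [map_poly _ (q i * _)]rmorphM mulrDr !mulrA.
apply: tcong_trans (tcongM E (tcong_refl _ _)) _.
by apply: tcong_sym; move: lG; rewrite /logder mul1r.
Qed.

End FactorLogDerivative.

(** The sum of the partial fraction functionals with weights [e i / m i] serves all [i] at once: for
    [j != i] the argument is a multiple of [w j ^+ (K * m j)], which the [j]-th functional kills. *)
Lemma exists_sample (F : fieldType) (charF : [pchar F] =i pred0) r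
    (w : 'I_r -> {poly F}) (m e : 'I_r -> nat) (K M : nat) (c : F) :
  c != 0 -> (forall i, (0 < m i)%N) -> (forall i, (w i).[0] != 0) ->
  (forall i j, j != i -> coprimep (w i) (w j)) ->
  (size (\prod_i w i ^+ (K * m i))%R <= M)%N ->
  exists cl : nat -> F, forall i (A : {poly F}), (size A < size (w i ^+ K))%N ->
  \sum_(l < M) cl l * (A * (w i ^+ (K * (m i).-1) *
     (c *: \prod_(j | j != i) w j ^+ (K * m j)))).[l%:R] =
  (e i)%:R / (m i)%:R * (A.[0] / (w i ^+ K).[0]).
Proof.
move=> c0 m0 w0 cop leM.
have /fin_all_exists [phi Hphi] := fun i =>
  partial_fraction_functional K c0 (m0 i) (w0 i) (cop i).
pose psi (a : {poly F}) := \sum_i (e i)%:R / (m i)%:R * phi i a.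
have [||cl Hcl] := @sampling_functional F charF M psi.
- move=> a b; rewrite /psi -big_split; apply: eq_bigr => i _.
  by case: (Hphi i) => -> _ _ _; rewrite mulrDr.
- move=> k a; rewrite /psi mulr_sumr; apply: eq_bigr => i _.
  by case: (Hphi i) => _ -> _ _; rewrite mulrCA.
exists cl => i A sA.
have wn0 j : w j != 0 by apply: contraNneq (w0 j) => ->; rewrite horner0.
rewrite -Hcl.
  rewrite /psi (bigD1 i) //= [X in _ + X]big1 ?addr0 => [|j ji].
    by case: (Hphi i) => _ _ -> // _; rewrite horner_exp.
  rewrite (bigD1 j) //= scalerAr.
  have -> : A * (w i ^+ (K * (m i).-1) * (w j ^+ (K * m j) *
     (c *: \prod_(i0 < r | (i0 != i) && (i0 != j)) w i0 ^+ (K * m i0)))) =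
     w j ^+ (K * m j) * (A * w i ^+ (K * (m i).-1) *
     (c *: \prod_(i0 < r | (i0 != i) && (i0 != j)) w i0 ^+ (K * m i0))) by ring.
  by case: (Hphi j) => _ _ _ ->; rewrite mulr0.
apply: leq_trans leM; have [->|An0] := eqVneq A 0.
  by rewrite mul0r size_poly0.
rewrite -!scalerAr (leq_trans (size_scale_leq _ _)) //.
rewrite [X in (_ <= size (polyseq X))%N](bigD1 i) //=.
have -> : (K * m i = K + K * (m i).-1)%N.
  by rewrite -{2}[K]muln1 -mulnDr add1n prednK.
set Q := \prod_(j | _) _; have Q0 : Q != 0.
  by rewrite prodf_seq_neq0; apply/allP => j _; rewrite expf_neq0 ?implybT.
have Z0 : w i ^+ (K * (m i).-1) * Q != 0 by rewrite mulf_neq0 ?expf_neq0.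
rewrite exprD -!mulrA !(size_mul _ Z0) ?expf_neq0 //.
move: sA; move: (size A) (size (w i ^+ K)) (size _); lia.
Qed.

(** * The sampled truncated logarithm and exponential *)

Section TruncatedLog.
Variable F : fieldType.
Hypothesis charF : [pchar F] =i pred0.
Variables (M : nat) (cl : nat -> F) (K : nat).
Implicit Types P q : {poly {poly F}}.

(* The truncated series of [P0^(K+1) log (P / P0)], [P0] the value at [t = 0]. *)
Definition tlog P : {poly {poly F}} :=
  - \sum_(k < K.+1) (k.+1%:R^-1)%:P *:
      ((P`_0)%:P ^+ (K - k) * ((P`_0)%:P - P) ^+ k.+1).

Lemma deriv_tlog P : (tlog P)^`() = P^`() * truncinv K.+1 P.
Proof.
rewrite /tlog derivN raddf_sum /= /truncinv mulr_sumr -sumrN.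
apply: eq_bigr => k _.
have da : ((P`_0)%:P ^+ (K - k))^`() = 0 by rewrite -rmorphXn derivC.
rewrite derivZ derivM da mul0r add0r deriv_exp derivB derivC sub0r /=.
set a := (P`_0)%:P ^+ _; set b := _ ^+ k.
have -> : a * (- P^`() * b *+ k.+1) = - (k.+1%:R *: (P^`() * (a * b))).
  by rewrite scaler_nat -mulr_natr -[in RHS]mulr_natr; ring.
rewrite scalerN opprK scalerA.
have -> : (k.+1%:R^-1)%:P * k.+1%:R = 1 :> {poly F}.
  by rewrite -polyCMn -polyCM mulVf ?natr_neq0 // polyC1.
by rewrite scale1r.
Qed.

Lemma deriv_sample q : (sample M cl q)^`() = sample M cl q^`().
Proof.
rewrite /sample raddf_sum /=; apply: eq_bigr => l _.
by rewrite derivZ deriv_map.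
Qed.

Lemma sample_tlog_coef0 P : (sample M cl (tlog P))`_0 = 0.
Proof.
rewrite coef_sample big1 // => l _.
rewrite /tlog -horner_coef0 hornerN horner_sum big1 ?oppr0 ?horner0 ?mulr0 //.
move=> k _; rewrite hornerZ hornerM [X in _ * (_ * X)]horner_exp.
by rewrite hornerD hornerN hornerC (horner_coef0 P) subrr exprS mul0r !mulr0.
Qed.

Lemma size_tlog P d : (size P <= d.+1)%N ->
  (size (sample M cl (tlog P)) <= (d * K.+1).+1)%N.
Proof.
move=> sP; have sumle (R : nzRingType) (I : Type) (s : seq I) (A : I -> {poly R}) n :
    (forall i, (size (A i) <= n)%N) -> (size (\sum_(i <- s) A i)%R <= n)%N.
  move=> hA; apply: (big_ind (fun a : {poly R} => size a <= n)%N) => //.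
    by rewrite size_poly0.
  by move=> a b ha hb; apply: leq_trans (size_polyD _ _) _; rewrite geq_max ha.
apply: (@sumle _ _ _ _ _) => l; apply: leq_trans (size_scale_leq _ _) _.
apply: leq_trans (size_poly _ _) _.
rewrite size_polyN; apply: sumle => k; apply: leq_trans (size_scale_leq _ _) _.
rewrite -rmorphXn /= mul_polyC; apply: leq_trans (size_scale_leq _ _) _.
apply: leq_trans (size_poly_exp_leq _ _) _.
rewrite ltnS; apply: leq_mul; last exact: ltn_ord.
suff : (size ((P`_0)%:P - P)%R <= d.+1)%N by case: (size _).
apply: leq_trans (size_polyD _ _) _; rewrite geq_max size_polyN sP andbT.
by apply: leq_trans (size_polyC_leq1 _) _.
Qed.

(** [P] now enters only through its values at the points [(t, y) = (i, l)] and [(0, l)]. The former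
    become oracle leaves, the latter constants of [F]. *)
Lemma horner_sample_tlog P (i : F) :
  (sample M cl (tlog P)).[i] =
  \sum_(l < M) \sum_(k < K.+1)
    (- cl l * k.+1%:R^-1 * (P`_0).[l%:R] ^+ (K - k)) *
    ((P`_0).[l%:R] - (P.[i%:P]).[l%:R]) ^+ k.+1.
Proof.
rewrite /sample horner_sum; apply: eq_bigr => l _.
rewrite hornerZ.
have E q : (map_poly (horner_eval l%:R) q).[i] = (q.[i%:P]).[l%:R].
  rewrite -[RHS]/(horner_eval l%:R q.[i%:P]) -horner_map.
  by congr (_.[_]); rewrite /= /horner_eval hornerC.
rewrite E /tlog hornerN hornerN !horner_sum mulrN -mulNr mulr_sumr.
apply: eq_bigr => k _.
rewrite hornerZ !hornerM hornerC !horner_exp hornerD hornerN !hornerC.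
by rewrite hornerD hornerN !mulrA.
Qed.

End TruncatedLog.

Lemma size_texp (F : fieldType) K (L : {poly F}) n :
  (size L <= n.+1)%N -> (size (texp K.+1 L) <= (n * K).+1)%N.
Proof.
move=> sL; rewrite /texp.
apply: (big_ind (fun a : {poly F} => size a <= (n * K).+1)%N) => //.
- by rewrite size_poly0.
- by move=> a b ha hb; apply: leq_trans (size_polyD _ _) _; rewrite geq_max ha.
move=> k _; apply: leq_trans (size_scale_leq _ _) _.
apply: leq_trans (size_poly_exp_leq _ _) _; rewrite ltnS leq_mul //.
  by move: sL; case: (size L).
by rewrite -ltnS.
Qed.

(** Truncating at order [K] and setting [t = 1] adds up the first [K] coefficients. This is again a
    linear functional, so it can be sampled as well; the bound on [size p] makes the truncation
    lossless. *)
Lemma exists_truncation (F : fieldType) (charF : [pchar F] =i pred0) K M :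
  exists c : nat -> F, forall p E : {poly F},
    (size p <= K)%N -> (size E <= M)%N -> tcong K p ((p`_0)%:P * E) ->
    p.[1] = p.[0] * \sum_(i < M) c i * E.[i%:R].
Proof.
pose phi (a : {poly F}) := \sum_(j < K) a`_j.
have [||c Hc] := @sampling_functional F charF M phi.
- by move=> a b; rewrite /phi -big_split; apply: eq_bigr => i _; rewrite coefD.
- by move=> k a; rewrite /phi mulr_sumr; apply: eq_bigr => i _; rewrite coefZ.
exists c => p E sp sE /tcongP pE; rewrite -Hc // horner_coef0 /phi mulr_sumr.
rewrite (horner_coef_wide _ sp); apply: eq_bigr => i _.
by rewrite expr1n mulr1 pE // coefCM.
Qed.

(** * Coprime bases *)

Lemma pairwise_perm (T : eqType) (R : rel T) (s : seq T) : ~~ pairwise R s ->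
  exists a b s', perm_eq s (a :: b :: s') && ~~ R a b.
Proof.
elim: s => [//|x s IHs]; rewrite pairwise_cons negb_and => /orP [|/IHs].
  case/allPn=> b sb nxb; exists x, b, (rem b s).
  by rewrite perm_cons perm_to_rem.
case=> a [b [s' /andP [pab nab]]]; exists a, b, (x :: s'); rewrite nab andbT.
rewrite (perm_trans (y := x :: a :: b :: s')) ?perm_cons //.
by apply/permP => y /=; lia.
Qed.

(** A triple holds an element and its exponents in the two products. A pair [u1, u2] with nontrivial
    gcd [d] is replaced by [u1 / d], [d], [u2 / d], the exponents of [d] being the sums. The total
    degree drops by the degree of [d], so this stops. *)
Lemma coprime_refinement (K : fieldType) (s : seq ({poly K} * nat * nat)) :
  all (fun x => (x.1.1 != 0) && (0 < x.1.2 + x.2)%N) s ->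
  exists s', [/\ all (fun x => (x.1.1 != 0) && (0 < x.1.2 + x.2)%N) s',
    pairwise (fun x y => coprimep x.1.1 y.1.1) s',
    \prod_(x <- s) x.1.1 ^+ x.1.2 = \prod_(x <- s') x.1.1 ^+ x.1.2
  & \prod_(x <- s) x.1.1 ^+ x.2 = \prod_(x <- s') x.1.1 ^+ x.2].
Proof.
have [n] := ubnP (\sum_(x <- s) (size (polyseq x.1.1)).-1).
elim: n s => // n IHn s lt_sn all_s.
case: (boolP (pairwise (fun x y => coprimep x.1.1 y.1.1) s)) => [pw|].
  by exists s.
case/pairwise_perm=> -[[u1 e1] c1] [[[u2 e2] c2] [s' /andP [ps ncop]]].
move: ncop lt_sn all_s; rewrite /= (perm_all _ ps) (perm_big _ ps) /= !big_cons /=.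
rewrite ltnS => ncop lt_sn /and3P [/andP [u1n0 ec1] /andP [u2n0 ec2] all_s'].
set d := gcdp u1 u2 in ncop.
have d1 : (1 < size d)%N.
  have d0 : (0 < size d)%N by rewrite size_poly_gt0 gcdp_eq0 (negPf u1n0).
  by move: ncop; rewrite coprimep_def -/d; lia.
have [v1 E1] : exists v1, u1 = v1 * d by apply/dvdpP; rewrite dvdp_gcdl.
have [v2 E2] : exists v2, u2 = v2 * d by apply/dvdpP; rewrite dvdp_gcdr.
have dn0 : d != 0 by rewrite -size_poly_gt0 ltnW.
have v1n0 : v1 != 0 by apply: contraNneq u1n0 => h; rewrite E1 h mul0r.
have v2n0 : v2 != 0 by apply: contraNneq u2n0 => h; rewrite E2 h mul0r.
have [||s'' [H1 H2 H3 H4]] := IHn ((v1, e1, c1) ::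
    (d, (e1 + e2)%N, (c1 + c2)%N) :: (v2, e2, c2) :: s').
- rewrite !big_cons /=; move: lt_sn.
  rewrite E1 E2 !size_mul //.
  have : (0 < size (v1))%N by rewrite size_poly_gt0.
  have : (0 < size (v2))%N by rewrite size_poly_gt0.
  move: (size (v1)) (size (v2)) d1 => x y.
  move: (size d) (\sum_(_ <- _) _)%N => z t; lia.
- by rewrite /= v1n0 v2n0 dn0 ec1 ec2 all_s' /= andbT; lia.
exists s''; split=> //.
- rewrite -H3 (perm_big _ ps) !big_cons /= E1 E2 !exprMn exprD; ring.
- rewrite -H4 (perm_big _ ps) !big_cons /= E1 E2 !exprMn exprD; ring.
Qed.

Lemma coprime_base (K : fieldType) (p q : {poly K}) : p != 0 -> q != 0 ->
  exists r (u : 'I_r -> {poly K}) (e c : 'I_r -> nat),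
    [/\ p = \prod_i u i ^+ e i, q = \prod_i u i ^+ c i,
        forall i, u i != 0, forall i, (0 < e i + c i)%N
      & forall i j, j != i -> coprimep (u i) (u j)].
Proof.
move=> p0 q0.
have [|s [H1 H2]] := @coprime_refinement K [:: (p, 1%N, 0%N); (q, 0%N, 1%N)].
  by rewrite /= p0 q0.
rewrite !big_cons !big_nil /= !mulr1 mul1r !expr1 => Ep Eq.
pose x0 : {poly K} * nat * nat := (0, 0%N, 0%N).
exists (size s), (fun i => (nth x0 s i).1.1), (fun i => (nth x0 s i).1.2),
  (fun i => (nth x0 s i).2); split.
- by rewrite Ep (big_nth x0) big_mkord.
- by rewrite Eq (big_nth x0) big_mkord.
- by move=> i; move/(all_nthP x0)/(_ i (ltn_ord i)): H1 => /andP [].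
- by move=> i; move/(all_nthP x0)/(_ i (ltn_ord i)): H1 => /andP [].
move=> i j ji; have := pairwiseP x0 H2.
case: (ltngtP i j) => [ij|ij|/val_inj ij] H; last by rewrite ij eqxx in ji.
  by apply: H; rewrite ?inE.
by rewrite coprimep_sym; apply: H; rewrite ?inE.
Qed.

Lemma fraction_numden (R : idomainType) (a : {fraction R}) :
  exists x y : R, y != 0 /\ tofrac y * a = tofrac x.
Proof.
elim/quotW: a => x; exists (frac x).1, (frac x).2; split; first exact: denom_ratioP.
unlock tofrac; rewrite -[LHS]FracField.pi_mul; apply/eqmodP.
rewrite /= FracField.equivfE /FracField.mulf !numden_Ratio ?oner_neq0 ?mul1r //.
- by rewrite mulr1.
- exact: denom_ratioP.
- exact: denom_ratioP.
Qed.

Lemma clear_denominators (R : idomainType) (u : {poly {fraction R}}) :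
  exists s (v : {poly R}), s != 0 /\ tofrac s *: u = map_poly (@tofrac R) v.
Proof.
elim/poly_ind: u => [|u a [s [v [s0 E]]]].
  by exists 1, 0; rewrite oner_eq0 rmorph0 scaler0.
have [x [y [y0 Ea]]] := fraction_numden a.
exists (y * s), (y *: v * 'X + (s * x)%:P); rewrite mulf_neq0 //; split=> //.
rewrite rmorphD /= (rmorphM (map_poly (@tofrac R))) /= map_polyX map_polyC.
rewrite map_polyZ /= -E !tofracM -Ea /=.
rewrite -!mul_polyC !polyCM; ring.
Qed.

(** The base is found over the fraction field and its denominators are cleared. The element [rho] is
    what remains of the Bezout identity: wherever it does not vanish, the specialized elements are
    still coprime. *)
Lemma coprime_base_idomain (R : idomainType) (p q : {poly R}) :
  p != 0 -> q != 0 ->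
  exists r (v : 'I_r -> {poly R}) (e c : 'I_r -> nat) (sp sq : R),
    [/\ sp != 0 /\ sp *: p = \prod_i v i ^+ e i,
        sq != 0 /\ sq *: q = \prod_i v i ^+ c i,
        forall i, v i != 0, forall i, (0 < e i + c i)%N
      & forall i j, j != i -> exists (rho : R) (A B : {poly R}),
          rho != 0 /\ A * v i + B * v j = rho%:P].
Proof.
move=> p0 q0; pose phi := map_poly (@tofrac R).
have phi_inj : injective phi.
  by apply: map_inj_poly => [x y /eqP|]; rewrite ?tofrac_eq ?tofrac0 // => /eqP.
have phi00 : phi 0 = 0 by exact: rmorph0.
have phi0 x : (phi x == 0) = (x == 0) by rewrite -phi00 (inj_eq phi_inj).
have [||r [u [e [c [Ep Eq u0 ec cop]]]]] := @coprime_base _ (phi p) (phi q).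
- by rewrite phi0.
- by rewrite phi0.
have /fin_all_exists [s /fin_all_exists [v H]] := fun i => clear_denominators (u i).
have scaled (f : 'I_r -> nat) (x : {poly R}) : phi x = \prod_i u i ^+ f i ->
    (\prod_i s i ^+ f i) *: x = \prod_i v i ^+ f i.
  move=> Ex; apply: phi_inj.
  have -> : phi (\prod_i v i ^+ f i) = \prod_i phi (v i) ^+ f i.
    by rewrite /phi rmorph_prod; apply: eq_bigr => i _; rewrite rmorphXn.
  have -> : phi ((\prod_i s i ^+ f i) *: x) = tofrac (\prod_i s i ^+ f i) *: phi x.
    exact: map_polyZ.
  have -> : tofrac (\prod_i s i ^+ f i) = \prod_i tofrac (s i) ^+ f i.
    by rewrite rmorph_prod; apply: eq_bigr => i _; rewrite rmorphXn.
  rewrite Ex -mul_polyC rmorph_prod -big_split /=; apply: eq_bigr => i _.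
  by case: (H i) => _ Ev; rewrite rmorphXn /= /phi -Ev -mul_polyC exprMn.
have prod0 (f : 'I_r -> nat) : \prod_i s i ^+ f i != 0.
  by rewrite prodf_seq_neq0; apply/allP => i _; rewrite expf_neq0 //; case: (H i).
exists r, v, e, c, (\prod_i s i ^+ e i), (\prod_i s i ^+ c i); split=> //.
- by rewrite scaled.
- by rewrite scaled.
- move=> i; rewrite -phi0 /phi; case: (H i) => si <-.
  by rewrite scaler_eq0 negb_or tofrac_eq0 si u0.
move=> i j ji; have /Bezout_eq1_coprimepP [[A B] /= EAB] := cop i j ji.
have [a [A' [a0 EA]]] := clear_denominators A.
have [b [B' [b0 EB]]] := clear_denominators B.
have [si Ei] := H i; have [sj Ej] := H j.
exists (a * b * s i * s j), (b * s j *: A'), (a * s i *: B').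
split; first by rewrite !mulf_neq0.
have phiD x y : phi (x + y) = phi x + phi y by exact: rmorphD.
have phiM x y : phi (x * y) = phi x * phi y by exact: rmorphM.
have phiZ x y : phi (x *: y) = (tofrac x)%:P * phi y by rewrite mul_polyC; exact: map_polyZ.
have phiC x : phi x%:P = (tofrac x)%:P by exact: map_polyC.
apply: phi_inj; rewrite phiD !phiM !phiZ phiC /phi.
rewrite -EA -EB -Ei -Ej !tofracM -!mul_polyC !polyCM.
rewrite -[RHS]mulr1 -EAB; ring.
Qed.

(** * Lifting the coprime base to power series *)

Lemma truncated_inverse (F : fieldType) (p : {poly F}) K : p`_0 != 0 ->
  exists tau, tcong K (tau * p) 1 /\ tau`_0 = (p`_0)^-1.
Proof.
move=> p0; exists ((p`_0 ^+ K.+1)^-1%:P * truncinv K.+1 p).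
have E : tcong K.+1 ((p`_0 ^+ K.+1)^-1%:P * truncinv K.+1 p * p) 1.
  have [s Es] := tcong_truncinv K.+1 p.
  exists ((p`_0 ^+ K.+1)^-1%:P * s).
  rewrite -mulrA [truncinv _ _ * _]mulrC Es mulrDr -polyCM mulVf ?expf_neq0 //.
  by rewrite mulrA.
split; first by apply: tcong_leq E.
move/tcongP: E => /(_ 0%N isT); rewrite coefM big_ord1 subnn coef1 /= => E.
by apply: (mulIf p0); rewrite E mulVf.
Qed.

Section Lifting.
Variables (F : fieldType) (R : idomainType).
Variables (theta : {rmorphism R -> {poly F}}) (theta0 : {rmorphism R -> F}).
Hypothesis thetaE : forall x, (theta x)`_0 = theta0 x.
Implicit Types v : {poly R}.

(** The swap makes [t] the outer variable, so that [tcong] means congruence modulo powers of [t]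
    with coefficients in [F[y]]. *)
Definition bivar v : {poly {poly F}} := swapXY (map_poly theta v).

Lemma coef_bivar v k j : (bivar v)`_k`_j = (theta v`_j)`_k.
Proof. by rewrite coef_swapXY coef_map. Qed.

Lemma bivar_coef0 v : (bivar v)`_0 = map_poly theta0 v.
Proof. by apply/polyP=> j; rewrite coef_bivar coef_map thetaE. Qed.

Lemma bivarZ x v : bivar (x *: v) = map_poly polyC (theta x) * bivar v.
Proof. by rewrite /bivar map_polyZ -mul_polyC rmorphM /= swapXY_polyC. Qed.

Lemma bivar_prod r (v : 'I_r -> {poly R}) (e : 'I_r -> nat) :
  bivar (\prod_i v i ^+ e i) = \prod_i bivar (v i) ^+ e i.
Proof.
by rewrite /bivar !rmorph_prod /=; apply: eq_bigr => i _; rewrite !rmorphXn.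
Qed.

(* Dividing by the leading coefficient in [F[[t]]], truncated. *)
Lemma monic_lift K v : theta0 (lead_coef v) != 0 ->
  exists (u : {poly {poly F}}) (tau : {poly F}),
  [/\ u`_0 = (theta0 (lead_coef v))^-1 *: map_poly theta0 v,
      forall k, (0 < k)%N -> (size (u`_k)%R < size (u`_0)%R)%N,
      tcong K.+1 (tau * theta (lead_coef v)) 1
    & tcong K.+1 u (map_poly polyC tau * bivar v)].
Proof.
move=> l0; have [|tau [tauE tau0]] := @truncated_inverse F (theta (lead_coef v)) K.+1.
  by rewrite thetaE.
pose u := take_poly K.+1 (map_poly polyC tau * bivar v); exists u, tau.
have uE k j : (k < K.+1)%N -> u`_k`_j = (tau * theta v`_j)`_k.
  move=> lt_kK; rewrite coef_take_poly lt_kK !coefM coef_sum.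
  by apply: eq_bigr => i _; rewrite coef_map coefCM coef_bivar.
have v0 : v != 0 by apply: contraNneq l0 => ->; rewrite lead_coef0 rmorph0.
have u0E : u`_0 = (theta0 (lead_coef v))^-1 *: map_poly theta0 v.
  apply/polyP=> j; rewrite uE // coefZ coef_map coefM big_ord1 subnn /=.
  by rewrite tau0 !thetaE.
have su0 : size u`_0 = size v.
  rewrite u0E size_scale ?invr_eq0 // size_poly_eq //.
split=> //; last exact: tcong_take.
move=> k k0; rewrite su0; case: (ltnP k K.+1) => [lt_kK|le_Kk]; last first.
  by rewrite coef_take_poly [(k < K.+1)%N]ltnNge le_Kk /= size_poly0 size_poly_gt0.
rewrite -(prednK (n := size v)) ?size_poly_gt0 // ltnS.
(* At the top degree in [y] the coefficient is that of [tau] times the leading coefficient, which is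
   1 up to order [K + 1] and so contributes nothing for [k > 0]. *)
apply/leq_sizeP => j; rewrite leq_eqVlt => /orP [/eqP <-|lt_j].
  rewrite uE // -/(lead_coef v); move/tcongP: tauE => -> //.
  by rewrite coef1; case: k k0 {lt_kK}.
rewrite uE // [v`_j]nth_default; first by rewrite rmorph0 mulr0 coef0.
by move: lt_j; rewrite prednK ?size_poly_gt0.
Qed.

Lemma lift_factors K r (v : 'I_r -> {poly R}) (m : 'I_r -> nat) (p : {poly R})
    (s : R) (c : F) (u : 'I_r -> {poly {poly F}}) (tau : 'I_r -> {poly F}) :
  s *: p = \prod_i v i ^+ m i -> s != 0 ->
  theta (lead_coef p) = c%:P ->
  (forall i, tcong K.+1 (tau i * theta (lead_coef (v i))) 1) ->
  (forall i, tcong K.+1 (u i) (map_poly polyC (tau i) * bivar (v i))) ->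
  tcong K.+1 (bivar p) (c%:P%:P * \prod_i u i ^+ m i).
Proof.
move=> E s0 lp tauE uE.
have lE : s * lead_coef p = \prod_i lead_coef (v i) ^+ m i.
  rewrite -lead_coefZ E lead_coef_prod.
  by apply: eq_bigr => i _; rewrite lead_coef_exp.
(* The scalar [s] is traded for leading coefficients, whose images under [theta] are known: the
   constant [c] for [p], and inverses of the [tau i] up to order [K + 1] for the [v i]. *)
have E2 : (\prod_i lead_coef (v i) ^+ m i) *: p = lead_coef p *: \prod_i v i ^+ m i.
  by rewrite -E scalerA -lE mulrC.
have := congr1 bivar E2; rewrite !bivarZ bivar_prod lp map_polyC /= => E3.
have E4 : tcong K.+1 (\prod_i map_poly polyC (tau i * theta (lead_coef (v i))) ^+ m i) 1.
  suff : tcong K.+1 (\prod_i map_poly polyC (tau i * theta (lead_coef (v i))) ^+ m i)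
      (\prod_(i < r) 1) by rewrite big1_eq.
  apply: tcong_prod => i; rewrite -[X in tcong _ _ X](expr1n _ (m i)).
  apply: tcongX; rewrite -[X in tcong _ _ X](rmorph1 (map_poly polyC)).
  exact: tcong_map.
rewrite -[X in tcong _ X _]mul1r.
apply: tcong_trans (tcongM (tcong_sym E4) (tcong_refl _ _)) _.
have -> : \prod_i map_poly polyC (tau i * theta (lead_coef (v i))) ^+ m i * bivar p =
  c%:P%:P * \prod_i (map_poly polyC (tau i) * bivar (v i)) ^+ m i.
  under eq_bigr => i _ do rewrite rmorphM exprMn.
  rewrite big_split /= -mulrA.
  have -> : \prod_i map_poly polyC (theta (lead_coef (v i))) ^+ m i =
            map_poly polyC (theta (\prod_i lead_coef (v i) ^+ m i)).
    rewrite !rmorph_prod; apply: eq_bigr => i _; by rewrite !rmorphXn.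
  rewrite E3; under [in RHS]eq_bigr => i _ do rewrite exprMn.
  rewrite big_split /=; ring.
apply: tcongM; first exact: tcong_refl.
by apply: tcong_prod => i; apply: tcongX; apply: tcong_sym.
Qed.

End Lifting.

(* [Omega] collects the genericity conditions on the base point [theta0]; the
   coefficients [cl] and [c1] do not depend on the direction [theta]. *)
Theorem generic_factor_formula (F : fieldType) (charF : [pchar F] =i pred0)
    (R : idomainType) (p q : {poly R}) (K M dt : nat) :
  p`_0 != 0 -> q`_0 != 0 ->
  exists2 Omega : R, Omega != 0 &
  forall (theta0 : {rmorphism R -> F}) (cp cpq : F),
  theta0 Omega != 0 -> cpq != 0 ->
  theta0 (lead_coef (p * q)) = cpq ->
  ((size (p * q)%R).-1 * K.+1 < M)%N ->
  exists cl c1 : nat -> F,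
  forall theta : {rmorphism R -> {poly F}},
  (forall x, (theta x)`_0 = theta0 x) ->
  theta (lead_coef p) = cp%:P -> theta (lead_coef (p * q)) = cpq%:P ->
  (size (theta p`_0)%R <= K.+1)%N -> (size (bivar theta (p * q)%R) <= dt.+1)%N ->
  (theta p`_0).[1] = (theta p`_0).[0] *
    \sum_(i < (dt * K.+1 * K).+1) c1 i *
      (texp K.+1 (sample M cl (tlog K (bivar theta (p * q))))).[i%:R].
Proof.
move=> p0 q0.
have pn0 : p != 0 by apply: contraNneq p0 => ->; rewrite coef0.
have qn0 : q != 0 by apply: contraNneq q0 => ->; rewrite coef0.
have [r [v [e [c [sp [sq [[sp0 Ep] [sq0 Eq] v0 ec bez]]]]]]] :=
  coprime_base_idomain pn0 qn0.
pose m i := (e i + c i)%N.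
have Epq : (sp * sq) *: (p * q) = \prod_i v i ^+ m i.
  rewrite -scalerA scalerAr Eq scalerAl Ep -big_split /=.
  by apply: eq_bigr => i _; rewrite exprD.
have v00 i : (v i)`_0 != 0.
  have : ((sp * sq) *: (p * q))`_0 != 0.
    by rewrite coefZ -horner_coef0 hornerM !horner_coef0 !mulf_neq0.
  rewrite Epq -horner_coef0 horner_prod (bigD1 i) //= mulf_eq0 negb_or.
  by rewrite horner_exp horner_coef0 expf_eq0 ec => /andP [].
have /fin_all_exists [rho Hrho] : forall ij : 'I_r * 'I_r, exists rho : R,
    rho != 0 /\ (ij.2 != ij.1 ->
      exists A B : {poly R}, A * v ij.1 + B * v ij.2 = rho%:P).
  move=> [i j] /=; case: (eqVneq j i) => [_|ji].
    by exists 1; rewrite oner_eq0.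
  by have [rho [A [B [r0 E]]]] := bez i j ji; exists rho; split=> // _; exists A, B.
(* Where this does not vanish, every base element keeps its degree in [y] and a nonzero value at
   [y = 0], and the Bezout constants survive, so the base remains coprime. *)
exists ((\prod_i (lead_coef (v i) * (v i)`_0)) * \prod_ij rho ij).
  rewrite mulf_neq0 //.
    by rewrite prodf_seq_neq0; apply/allP => i _; rewrite mulf_neq0 ?lead_coef_eq0.
  by rewrite prodf_seq_neq0; apply/allP => ij _; case: (Hrho ij).
move=> theta0 cp cpq; rewrite rmorphM !rmorph_prod /= mulf_eq0 negb_or.
rewrite !prodf_seq_neq0 => /andP [/allP Hv /allP Hr] cpq0 lpq ltM.
have lv0 i : theta0 (lead_coef (v i)) != 0.
  have := Hv i (mem_index_enum _).
  by rewrite /= rmorphM mulf_eq0 negb_or => /andP [].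
have vv0 i : theta0 (v i)`_0 != 0.
  have := Hv i (mem_index_enum _).
  by rewrite /= rmorphM mulf_eq0 negb_or => /andP [].
pose w i := (theta0 (lead_coef (v i)))^-1 *: map_poly theta0 (v i).
have w0 i : (w i).[0] != 0.
  by rewrite hornerZ horner_coef0 coef_map; apply: mulf_neq0; [rewrite invr_eq0 | apply: vv0].
have cop i j : j != i -> coprimep (w i) (w j).
  move=> ji; case: (Hrho (i, j)) => rij0 /(_ ji) [A [B /= E]].
  rewrite /w coprimepZl ?invr_eq0 // coprimepZr ?invr_eq0 //.
  apply/Bezout_eq1_coprimepP.
  have r0 := Hr (i, j) (mem_index_enum _); rewrite /= in r0.
  exists ((theta0 (rho (i, j)))^-1 *: map_poly theta0 A,
          (theta0 (rho (i, j)))^-1 *: map_poly theta0 B) => /=.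
  rewrite -!scalerAl -scalerDr -!rmorphM -rmorphD /= E map_polyC /=.
  by rewrite -mul_polyC -polyCM mulVf.
(* The product of the monic specializations is [P(0, y)] up to a constant, which bounds the degree
   of its powers and hence the number of sample points. *)
have prodw : \prod_i w i ^+ m i = cpq^-1 *: map_poly theta0 (p * q).
  have lE : sp * sq * lead_coef (p * q) = \prod_i lead_coef (v i) ^+ m i.
    rewrite -lead_coefZ Epq lead_coef_prod.
    by apply: eq_bigr => i _; rewrite lead_coef_exp.
  have := congr1 (map_poly theta0) Epq.
  rewrite map_polyZ rmorph_prod /= => E.
  have spq : theta0 (sp * sq) * cpq = \prod_i theta0 (lead_coef (v i)) ^+ m i.
    rewrite -lpq -rmorphM lE rmorph_prod.
    by apply: eq_bigr => i _; rewrite rmorphXn.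
  have spq0 : theta0 (sp * sq) * cpq != 0.
    by rewrite spq prodf_seq_neq0; apply/allP => i _; rewrite expf_neq0.
  apply: (scalerI spq0); rewrite scalerA mulfK // E spq -mul_polyC rmorph_prod.
  rewrite -big_split /=; apply: eq_bigr => i _.
  rewrite rmorphXn rmorphXn /= -exprMn mul_polyC /w scalerA divff ?scale1r //.
have sw : (size (\prod_i w i ^+ (K.+1 * m i))%R <= M)%N.
  have -> : \prod_i w i ^+ (K.+1 * m i) = (\prod_i w i ^+ m i) ^+ K.+1.
    by rewrite -prodrXl; apply: eq_bigr => i _; rewrite -exprM mulnC.
  apply: leq_trans (size_poly_exp_leq _ _) _; apply: leq_ltn_trans ltM.
  rewrite leq_mul2r; apply/orP; right; rewrite prodw.
  suff : (size (cpq^-1 *: map_poly theta0 (p * q))%R <= size (p * q)%R)%N.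
    by move/(leq_sub2r 1); rewrite !subn1.
  by apply: leq_trans (size_scale_leq _ _) _; apply: size_poly.
have m0 i : (0 < m i)%N by apply: ec.
have [cl Hcl] := exists_sample charF e (expf_neq0 K.+1 cpq0) m0 w0 cop sw.
have [c1 Hc1] := exists_truncation charF K.+1 (dt * K.+1 * K).+1.
exists cl, c1 => theta thetaE lp lpq' sp_K sP.
have /fin_all_exists [u /fin_all_exists [tau Hu]] :=
  fun i => monic_lift thetaE K (lv0 i).
have uw i : (u i)`_0 = w i by case: (Hu i).
have tauE i : tcong K.+1 (tau i * theta (lead_coef (v i))) 1 by case: (Hu i).
have uE i : tcong K.+1 (u i) (map_poly polyC (tau i) * bivar theta (v i)).
  by case: (Hu i).
have P_factors : tcong K.+1 (bivar theta (p * q)) (cpq%:P%:P * \prod_i u i ^+ m i).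
  exact: lift_factors Epq (mulf_neq0 sp0 sq0) lpq' tauE uE.
have G_factors : tcong K.+1 (bivar theta p) (cp%:P%:P * \prod_i u i ^+ e i).
  exact: lift_factors Ep sp0 lp tauE uE.
have GE : map_poly (horner_eval 0) (bivar theta p) = theta p`_0.
  by apply/polyP=> k; rewrite coef_map /= /horner_eval horner_coef0 coef_bivar.
have LD := @logder_factor F charF r u m e cpq cp K _ _ cpq0 m0 _ _ P_factors G_factors M cl.
rewrite GE in LD; apply: Hc1 => //.
  by apply: size_texp; apply: size_tlog.
apply: tcong_texp => //; first exact: sample_tlog_coef0.
rewrite deriv_sample deriv_tlog //; apply: LD.
- by move=> i k k0; case: (Hu i) => _ -> .
- by move=> i; rewrite uw.
- move=> i A; rewrite !uw => sA; rewrite -Hcl //.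
  apply: eq_bigr => l _; congr (_ * (_ * (_ * (_ *: _))).[_]).
  by apply: eq_bigr => j _; rewrite uw.
Qed.

(** * Multivariate polynomials *)

Lemma rmorph_mpolyE n (R : nzRingType) (S : nzRingType)
    (phi : {rmorphism {mpoly R[n]} -> S}) (p : {mpoly R[n]}) :
  phi p = \sum_(m <- msupp p) phi (p@_m)%:MP * \prod_i phi 'X_i ^+ m i.
Proof.
rewrite {1}[p]mpolyE rmorph_sum; apply: eq_bigr => m _ /=.
rewrite -mul_mpolyC rmorphM mpolyXE_id rmorph_prod; congr (_ * _).
by apply: eq_bigr => i _; rewrite rmorphXn.
Qed.

Lemma rmorph_mpoly_ext n (R : nzRingType) (S : nzRingType)
    (phi psi : {rmorphism {mpoly R[n]} -> S}) :
  (forall c, phi c%:MP = psi c%:MP) -> (forall i, phi 'X_i = psi 'X_i) ->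
  phi =1 psi.
Proof.
move=> hC hX p; rewrite !rmorph_mpolyE; apply: eq_bigr => m _.
by rewrite hC; congr (_ * _); apply: eq_bigr => i _; rewrite hX.
Qed.

Section Degree.
Variables (n : nat) (R S : comNzRingType).
Variable phi : {rmorphism {mpoly R[n]} -> {poly S}}.
Hypothesis phiC : forall c, (size (phi c%:MP) <= 1)%N.
Hypothesis phiX : forall i, (size (phi 'X_i) <= 2)%N.

Let size_monomial (m : 'X_{1..n}) : (size (\prod_i phi 'X_i ^+ m i)%R <= (mdeg m).+1)%N.
Proof.
rewrite mdegE.
apply: (big_ind2 (fun (a : {poly S}) x => (size a <= x.+1)%N))
  => [|a x b y ha hb|i _].
- by rewrite size_poly1.
- by apply: leq_trans (size_polyMleq _ _) _; move: (size a) (size b) ha hb; lia.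
apply: leq_trans (size_poly_exp_leq _ _) _; rewrite ltnS.
by move: (phiX i); case: (size _) => [|[|[|]]] //= _; rewrite ?mul0n ?mul1n.
Qed.

Lemma size_rmorph_mpoly p : (size (phi p) <= msize p)%N.
Proof.
rewrite rmorph_mpolyE big_seq.
apply: (big_ind (fun a : {poly S} => size a <= msize p)%N).
- by rewrite size_poly0.
- by move=> a b ha hb; apply: leq_trans (size_polyD _ _) _; rewrite geq_max ha.
move=> m /msize_mdeg_lt lt_m; apply: leq_trans (size_polyMleq _ _) _.
apply: leq_trans lt_m; move: (size_monomial m) (phiC p@_m).
by move: (size _) (size _); lia.
Qed.

Lemma coef_prod_top (I : Type) (s : seq I) (A : I -> {poly S}) (d : I -> nat) :
  (forall i, (size (A i) <= (d i).+1)%N) ->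
  (\prod_(i <- s) A i)`_(\sum_(i <- s) d i) = \prod_(i <- s) (A i)`_(d i).
Proof.
move=> hA; elim: s => [|i s IHs]; first by rewrite !big_nil coef1.
have hs : (size (\prod_(i <- s) A i)%R <= (\sum_(i <- s) d i).+1)%N.
  apply: (big_ind2 (fun (a : {poly S}) x => (size a <= x.+1)%N)) => [|a x b y ha hb|//].
    by rewrite size_poly1.
  by apply: leq_trans (size_polyMleq _ _) _; move: (size a) (size b) ha hb; lia.
rewrite !big_cons coefM -IHs; move: hs {IHs}.
set Q := \prod_(j <- s) A j; set t := (\sum_(j <- s) d j)%N => hs.
have lt_d : (d i < (d i + t).+1)%N by lia.
rewrite (bigD1 (Ordinal lt_d)) //= addKn big1 ?addr0 // => j; rewrite -val_eqE /= => ji.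
case: (ltngtP j (d i)) ji => // ltj _.
  rewrite [X in _ * X]nth_default ?mulr0 //; apply: leq_trans hs _; lia.
by rewrite [X in X * _]nth_default ?mul0r //; apply: leq_trans (hA i) _.
Qed.

(** Only monomials of maximal degree reach this coefficient, and each variable contributes only its
    slope. For a translation along [a] it is the top homogeneous part evaluated at [a]. *)
Lemma coef_rmorph_mpoly_top p :
  (phi p)`_(msize p).-1 =
  \sum_(m <- msupp p | mdeg m == (msize p).-1)
    (phi (p@_m)%:MP)`_0 * \prod_i (phi 'X_i)`_1 ^+ m i.
Proof.
rewrite rmorph_mpolyE coef_sum [RHS]big_mkcond /= !big_seq.
apply: eq_bigr => m hm; have [c Ec] : exists c, phi (p@_m)%:MP = c%:P.
  by exists (phi (p@_m)%:MP)`_0; apply: size1_polyC.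
rewrite Ec coefCM coefC /=; case: eqP => [<-|/eqP ne].
  congr (_ * _).
  have hX i : (size (phi 'X_i ^+ m i)%R <= (m i).+1)%N.
    apply: leq_trans (size_poly_exp_leq _ _) _; rewrite ltnS.
    by move: (phiX i); case: (size _) => [|[|[|]]] //= _; rewrite ?mul0n ?mul1n.
  rewrite mdegE coef_prod_top //; apply: eq_bigr => i _.
  have := @coef_prod_top _ (index_enum 'I_(m i)) (fun=> phi 'X_i) (fun=> 1%N) (fun=> phiX i).
  by rewrite !prodr_const !sum_nat_const card_ord muln1.
rewrite nth_default ?mulr0 //; apply: leq_trans (size_monomial m) _.
by move/msize_mdeg_lt: hm => hm; move: ne hm; rewrite /=; lia.
Qed.

End Degree.

Section Points.
Variable F : fieldType.
Hypothesis charF : [pchar F] =i pred0.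

Lemma digits_inj B n (a b : 'I_n -> nat) :
  (forall i, (a i < B)%N) -> (forall i, (b i < B)%N) ->
  (\sum_i a i * B ^ i = \sum_i b i * B ^ i)%N -> a =1 b.
Proof.
elim: n a b => [|n IHn] a b ha hb; first by move=> _ [].
rewrite !big_ord_recl /= !expn0 !muln1 => E.
have shift (c : 'I_n.+1 -> nat) :
    (\sum_(i < n) c (lift ord0 i) * B ^ bump 0 i =
     (\sum_(i < n) c (lift ord0 i) * B ^ i) * B)%N.
  by rewrite big_distrl; apply: eq_bigr => i _; rewrite /= /bump add1n expnSr mulnA.
rewrite !shift in E; have B0 : (0 < B)%N := leq_ltn_trans (leq0n _) (ha ord0).
have E0 : a ord0 = b ord0.
  have := congr1 (modn^~ B) E; rewrite /= ![(_ + _ * B)%N]addnC !modnMDl.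
  by rewrite !modn_small.
have E1 := IHn (a \o lift ord0) (b \o lift ord0) (fun i => ha _) (fun i => hb _).
move: E; rewrite E0 => /addnI /eqP; rewrite eqn_pmul2r // => /eqP /E1 E2 i.
by case: (unliftP ord0 i) => [j|] -> //; apply: E2.
Qed.

Lemma exists_nonroot (p : {poly F}) : p != 0 -> exists x : F, p.[x] != 0.
Proof.
move=> p0; pose s := [seq (i%:R : F) | i <- iota 0 (size p)].
have us : uniq s by rewrite map_inj_uniq ?iota_uniq //; apply: natr_inj.
case: (boolP (all (root p) s)) => [rs|/allPn [x _ nx]]; last by exists x.
by have := max_poly_roots p0 rs us; rewrite size_map size_iota ltnn.
Qed.

(* Kronecker substitution. *)
Lemma exists_nonzero_point n (p : {mpoly F[n]}) :
  p != 0 -> exists x : 'I_n -> F, p.@[x] != 0.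
Proof.
move=> p0; pose B := msize p.
pose h (i : 'I_n) : {poly F} := 'X^(B ^ i).
pose code (m : 'X_{1..n}) := (\sum_i m i * B ^ i)%N.
have hE (m : 'X_{1..n}) : \prod_i h i ^+ m i = 'X^(code m).
  rewrite /code; elim/big_rec2: _ => [|i a b _ ->]; first by rewrite expr0.
  by rewrite /h -exprM -exprD mulnC.
have kE : mmap (@polyC F) h p = \sum_(m <- msupp p) (p@_m)%:P * 'X^(code m).
  by rewrite /mmap; apply: eq_bigr => m _; rewrite /mmap1 hE.
have lt_B (m : 'X_{1..n}) i : m \in msupp p -> (m i < B)%N.
  move/msize_mdeg_lt; apply: leq_ltn_trans; rewrite mdegE (bigD1 i) //=; exact: leq_addr.
have nz : mmap (@polyC F) h p != 0.
  apply: contraNneq p0 => E; apply/eqP/mpolyP => m; rewrite mcoeff0.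
  case: (boolP (m \in msupp p)) => [hm|/memN_msupp_eq0 //].
  have := congr1 (fun q : {poly F} => q`_(code m)) E.
  rewrite kE coef_sum coef0 (bigD1_seq m) ?msupp_uniq //= coefCM coefXn eqxx mulr1.
  rewrite big_seq_cond big1 ?addr0 // => m' /andP [hm' ne].
  rewrite coefCM coefXn; case: eqP => [E'|_]; last by rewrite mulr0.
  case/eqP: ne; apply/mnmP; apply: (@digits_inj B) => [i|i|] //; by [exact: lt_B|].
have [x nx] := exists_nonroot nz; exists (fun i => x ^+ (B ^ i)).
apply: contraNneq nx => E; apply/eqP; rewrite -[RHS]E mevalE kE horner_sum.
apply: eq_bigr => m _; rewrite hornerM hornerC hornerXn; congr (_ * _).
rewrite /code; elim/big_rec2: _ => [|i a b _ <-]; first by rewrite expr0.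
by rewrite -exprM -exprD mulnC.
Qed.

Lemma mpoly_ext n (p q : {mpoly F[n]}) : (forall x, p.@[x] = q.@[x]) -> p = q.
Proof.
move=> E; apply/eqP; rewrite -subr_eq0; apply/negPn/negP.
by case/exists_nonzero_point=> x; rewrite mevalB E subrr eqxx.
Qed.

End Points.

(** * The factor formula for multivariate polynomials *)

Section Shift.
Variables (F : fieldType) (n : nat).
Hypothesis charF : [pchar F] =i pred0.
Implicit Types (a b xi : 'I_n -> F) (p : {mpoly F[n]}).

(* [p(z + y a)] as a polynomial in [y]. *)
Definition shift a : {mpoly F[n]} -> {poly {mpoly F[n]}} :=
  mmap (polyC \o @mpolyC n F) (fun i => ('X_i)%:P + ((a i)%:MP)%:P * 'X).
HB.instance Definition _ a := GRing.RMorphism.copy (shift a) (shift a).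

(* [p(b + t xi)] as a polynomial in [t]. *)
Definition line b xi : {mpoly F[n]} -> {poly F} :=
  mmap (@polyC F) (fun i => (b i)%:P + (xi i)%:P * 'X).
HB.instance Definition _ b xi := GRing.RMorphism.copy (line b xi) (line b xi).

Lemma shiftC a c : shift a c%:MP = (c%:MP)%:P.
Proof. exact: mmapC. Qed.

Lemma shiftX a i : shift a 'X_i = ('X_i)%:P + ((a i)%:MP)%:P * 'X.
Proof. by rewrite /shift mmapX mmap1U. Qed.

Lemma lineC b xi c : line b xi c%:MP = c%:P.
Proof. exact: mmapC. Qed.

Lemma lineX b xi i : line b xi 'X_i = (b i)%:P + (xi i)%:P * 'X.
Proof. by rewrite /line mmapX mmap1U. Qed.

Let size_affine (R : nzRingType) (c d : R) : (size (c%:P + d%:P * 'X)%R <= 2)%N.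
Proof.
rewrite addrC -[d%:P * 'X]/(_) size_MXaddC; case: ifP => // _.
by rewrite ltnS size_polyC_leq1.
Qed.

Lemma size_shift a p : (size (shift a p) <= msize p)%N.
Proof.
apply: (@size_rmorph_mpoly n F _ (shift a)) => [c|i] /=.
  by rewrite shiftC size_polyC_leq1.
by rewrite shiftX size_affine.
Qed.

Lemma size_line b xi p : (size (line b xi p) <= msize p)%N.
Proof.
apply: (@size_rmorph_mpoly n F _ (line b xi)) => [c|i] /=.
  by rewrite lineC size_polyC_leq1.
by rewrite lineX size_affine.
Qed.

Lemma shift_coef0 a p : (shift a p)`_0 = p.
Proof.
rewrite -horner_coef0 -[LHS]/((horner_eval 0 \o shift a) p).
apply: (@rmorph_mpoly_ext _ _ _ (horner_eval 0 \o shift a) idfun) => [c|i] /=.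
  by rewrite shiftC /horner_eval hornerC.
by rewrite shiftX /horner_eval hornerD hornerM !hornerC hornerX mulr0 addr0.
Qed.

Lemma horner_line b xi p c : (line b xi p).[c] = p.@[fun i => b i + c * xi i].
Proof.
rewrite -[LHS]/((horner_eval c \o line b xi) p).
apply: (@rmorph_mpoly_ext _ _ _ (horner_eval c \o line b xi) (meval _)) => [d|i] /=.
  by rewrite lineC mevalC /horner_eval hornerC.
by rewrite lineX mevalXU /horner_eval hornerD hornerM !hornerC hornerX mulrC.
Qed.

Lemma horner_shift a p z c :
  (map_poly (meval z) (shift a p)).[c] = p.@[fun i => z i + c * a i].
Proof.
rewrite -[LHS]/((horner_eval c \o map_poly (meval z) \o shift a) p).
apply: (@rmorph_mpoly_ext _ _ _
  (horner_eval c \o map_poly (meval z) \o shift a) (meval _)) => [d|i] /=.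
  by rewrite shiftC map_polyC /= !mevalC /horner_eval hornerC.
rewrite shiftX rmorphD rmorphM /= !map_polyC map_polyX /= mevalC !mevalXU.
by rewrite /horner_eval hornerD hornerM !hornerC hornerX mulrC.
Qed.

(** Each variable is sent to [b_i + t xi_i + y a_i], which is affine in [t]. *)
Lemma size_bivar_shift a b xi p : (size (bivar (line b xi) (shift a p)) <= msize p)%N.
Proof.
pose phi := (@swapXY F \o map_poly (line b xi)) \o shift a.
apply: (@size_rmorph_mpoly n F _ phi) => [c|i] /=.
  by rewrite shiftC map_polyC /= lineC swapXY_polyC map_polyC size_polyC_leq1.
rewrite shiftX rmorphD rmorphM /= !map_polyC map_polyX /= lineC lineX.
rewrite rmorphD rmorphM /= !swapXY_polyC swapXY_X map_polyC.
rewrite rmorphD rmorphM /= !map_polyC map_polyX /=.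
have -> : (b i)%:P%:P + (xi i)%:P%:P * 'X + (a i)%:P%:P * 'Y =
    ((b i)%:P + (a i)%:P * 'X)%:P + (xi i)%:P%:P * 'X.
  by rewrite polyCD polyCM; ring.
exact: size_affine.
Qed.

(** The coefficient of the top power of [y] in [p(z + y a)] is the top homogeneous part of [p] at
    [a], and [a] is taken off its zeros. *)
Lemma exists_shift_monic p : p != 0 -> exists a c,
  c != 0 /\ lead_coef (shift a p) = c%:MP.
Proof.
move=> p0; have top0 : pihomog mdeg (msize p).-1 p != 0.
  apply: contraNneq (p0) => /(congr1 (mcoeff (mlead p))) /eqP.
  rewrite mcoeff0 pihomogE raddf_sum big_mkcond /=.
  rewrite (bigD1_seq (mlead p)) ?msupp_uniq ?mlead_supp //=.
  rewrite -(mlead_deg p0) eqxx mcoeffZ mcoeffX eqxx mulr1 big1 ?addr0.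
    by rewrite mleadc_eq0.
  by move=> m ne; case: ifP; rewrite ?mcoeff0 // mcoeffZ mcoeffX (negPf ne) mulr0.
have [a ha] := exists_nonzero_point charF top0.
exists a, (pihomog mdeg (msize p).-1 p).@[a]; split=> //.
have E : (shift a p)`_(msize p).-1 = ((pihomog mdeg (msize p).-1 p).@[a])%:MP.
  rewrite (@coef_rmorph_mpoly_top n F _ (shift a)) /= => [|c|i]; last 2 first.
  - by rewrite shiftC size_polyC_leq1.
  - by rewrite shiftX size_affine.
  rewrite pihomogE (raddf_sum (meval a)) (raddf_sum (@mpolyC n F)) /=; apply: eq_bigr => m _.
  rewrite shiftC coefC /= mevalZ mevalX mpolyCM; congr (_ * _).
  rewrite rmorph_prod; apply: eq_bigr => i _.
  by rewrite shiftX coefD coefC coefMX coefC /= add0r rmorphXn.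
have sE : size (shift a p) = msize p.
  apply/eqP; rewrite eqn_leq size_shift /=.
  have s0 : (0 < msize p)%N by rewrite lt0n mmeasure_poly_eq0.
  rewrite -(prednK s0) ltnNge; apply/negP => le_s.
  by move: E; rewrite nth_default // => /esym/eqP; rewrite mpolyC_eq0 (negPf ha).
by rewrite lead_coefE sE E.
Qed.

End Shift.

(** * Expressions with oracle leaves *)

(* [OLeaf s b] stands for the substitution [f(s x + b)] into an oracle [f]. *)
Inductive oexpr (F : Type) (n : nat) : Type :=
| OConst of F
| OLeaf of F & ('I_n -> F)
| OAdd of oexpr F n & oexpr F n
| OMul of oexpr F n & oexpr F n.

Arguments OConst {F n}.
Arguments OLeaf {F n}.

Fixpoint osize F n (e : oexpr F n) : nat :=
  match e with
  | OConst _ | OLeaf _ _ => 1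
  | OAdd a b | OMul a b => (osize a + osize b).+1
  end.

(** One scalar for all variables suffices: the points to be reached are [b + i (x - b) + l a]. *)
Definition affine_subst (K : comNzRingType) n (s : K) (b : 'I_n -> K)
    (p : {mpoly K[n]}) : {mpoly K[n]} :=
  p \mPo [tuple s%:MP * 'X_i + (b i)%:MP | i < n].

Fixpoint oeval F (K : comNzRingType) (phi : F -> K) n (p : {mpoly K[n]})
    (e : oexpr F n) : {mpoly K[n]} :=
  match e with
  | OConst c => (phi c)%:MP
  | OLeaf s b => affine_subst (phi s) (phi \o b) p
  | OAdd a b => oeval phi p a + oeval phi p b
  | OMul a b => oeval phi p a * oeval phi p b
  end.

Section Combinators.
Variables (F : fieldType) (n : nat) (f : {mpoly F[n]}) (x : 'I_n -> F).
Implicit Types e : oexpr F n.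

Definition osum M (E : nat -> oexpr F n) : oexpr F n :=
  foldr (@OAdd F n) (OConst 0) [seq E i | i <- iota 0 M].

Definition opow e k : oexpr F n := iter k (OMul e) (OConst 1).

Lemma osize_osum M E s : (forall i, (i < M)%N -> (osize (E i) <= s)%N) ->
  (osize (osum M E) <= M * s.+1 + 1)%N.
Proof.
rewrite /osum => hE.
have {hE} : forall i, i \in iota 0 M -> (osize (E i) <= s)%N.
  by move=> i; rewrite mem_iota => /andP [_]; apply: hE.
have -> : (M * s.+1 = size (iota 0 M) * s.+1)%N by rewrite size_iota.
elim: (iota 0 M) => //= i l IHl hE.
have h1 := hE i (mem_head _ _).
have h2 : (osize (foldr (@OAdd F n) (OConst 0%R) [seq E i | i <- l])
            <= size l * s.+1 + 1)%N.
  by apply: IHl => j jl; apply: hE; rewrite inE jl orbT.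
by rewrite mulSn; move: h1 h2; move: (osize _) (osize _) (size l * _)%N; lia.
Qed.

Lemma osize_opow e k D s : (osize e <= s)%N -> (k <= D)%N ->
  (osize (opow e k) <= D * s.+1 + 1)%N.
Proof.
move=> he kD; apply: (@leq_trans (k * s.+1 + 1)); last first.
  by rewrite leq_add2r leq_mul2r kD orbT.
by elim: k {kD} => [//|k IHk]; rewrite /= mulSn -/(opow e k); lia.
Qed.

Lemma osize_scale (c : F) e : osize (OMul (OConst c) e) = (osize e).+2.
Proof. by []. Qed.

Definition oval e := (oeval id f e).@[x].

Lemma ovalC c : oval (OConst c) = c.
Proof. exact: mevalC. Qed.

Lemma ovalD a b : oval (OAdd a b) = oval a + oval b.
Proof. exact: mevalD. Qed.

Lemma ovalM a b : oval (OMul a b) = oval a * oval b.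
Proof. exact: mevalM. Qed.

Lemma oval_leaf s b : oval (OLeaf s b) = f.@[fun i => s * x i + b i].
Proof.
rewrite /oval /= /affine_subst comp_mpoly_meval; apply: meval_eq => i.
by rewrite tnth_mktuple mevalD mevalM !mevalC mevalXU.
Qed.

Lemma oval_sum M E : oval (osum M E) = \sum_(i < M) oval (E i).
Proof.
rewrite -(big_mkord xpredT (fun i => oval (E i))) /index_iota subn0 /osum.
elim: (iota 0 M) => [|i s IHs] /=; first by rewrite big_nil ovalC.
by rewrite ovalD IHs big_cons.
Qed.

Lemma oval_pow e k : oval (opow e k) = oval e ^+ k.
Proof.
by elim: k => [|k IHk]; rewrite /= ?ovalC // ovalM -/(opow e k) IHk exprS.
Qed.

End Combinators.

(** Applied to leading coefficients in [y]: once that of the shifted [f] is constant, so is that of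
    the shifted [g]. *)
Lemma mpolyC_factor (F : fieldType) n (x y : {mpoly F[n]}) c :
  c != 0 -> x * y = c%:MP -> exists d, x = d%:MP.
Proof.
move=> c0 xy; have : x * y != 0 by rewrite xy mpolyC_eq0.
rewrite mulf_eq0 negb_or => /andP [x0 y0].
exists x@_0; apply: msize1_polyC.
have := msizeM x0 y0; rewrite xy msizeC c0.
move: x0 y0; rewrite -(mmeasure_poly_eq0 mdeg x) -(mmeasure_poly_eq0 mdeg y).
by move: (msize x) (msize y); lia.
Qed.

(** It follows the nesting of the expression for [g]: a power of a difference, the sampled
    logarithm, the exponential, the final sum. The difference [P(0, l) - P(i, l)] has size 5, whence
    the 6; every [+ 2] pays for multiplication by a constant. *)
Definition obound (d : nat) : nat :=
  let D := d.+1 in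
  let inner := (D * ((D * 6 + 1) + 2).+1 + 1)%N in
  let lg := ((d * D).+1 * inner.+1 + 1)%N in
  let ex := (D * ((D * lg.+1 + 1) + 2).+1 + 1)%N in
  (((d * D * d).+1 * (ex + 2).+1 + 1) + 2)%N.

Theorem factor_oexpr (F : fieldType) (charF : [pchar F] =i pred0) n
    (f g h : {mpoly F[n]}) d :
  h != 0 -> f = g * h -> (msize f <= d.+1)%N ->
  exists2 e : oexpr F n, (osize e <= obound d)%N & oeval id f e = g.
Proof.
move=> h0 fgh sf; case: (eqVneq g 0) => [->|g0].
  by exists (OConst 0) => //=; rewrite mpolyC0.
have f0 : f != 0 by rewrite fgh mulf_neq0.
have sg : (msize g <= d.+1)%N.
  apply: leq_trans sf; rewrite fgh msizeM //.
  have : (0 < msize h)%N by rewrite lt0n mmeasure_poly_eq0.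
  by move: (msize g) (msize h); lia.
have [a [c [c0 lf]]] := exists_shift_monic charF f0.
pose p := shift a g; pose q := shift a h.
have pq : p * q = shift a f by rewrite fgh (rmorphM (shift a)).
have p0 : p`_0 != 0 by rewrite shift_coef0.
have q0 : q`_0 != 0 by rewrite shift_coef0.
(* Order [d] suffices since [g] has degree at most [d]; the number of samples exceeds the degree in
   [y] of [P(0, y)^(d+1)]. *)
have [Omega Om0 HOm] := generic_factor_formula charF d (d * d.+1).+1 d p0 q0.
have [b hb] := exists_nonzero_point charF Om0.
have [cp lp] : exists cp, lead_coef p = cp%:MP.
  apply: (@mpolyC_factor _ _ _ (lead_coef q) c c0).
  by rewrite -lead_coefM pq; exact: lf.
have [||cl [c1 H]] := HOm (meval b) cp c hb c0.
- by rewrite /= pq lf; exact: mevalC.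
- rewrite pq ltnS leq_mul2r orbC /=.
  by have := size_shift a f; move: sf; move: (size _); lia.
pose p0l (l : nat) := f.@[fun j => b j + l%:R * a j].
(* This is [f(b + i (x - b) + l a)], with the terms not involving [x] collected in the shift. *)
pose leaf (i l : nat) : oexpr F n :=
  OLeaf i%:R (fun j => b j - i%:R * b j + l%:R * a j).
pose inner (i l k : nat) := OMul (OConst (- cl l * k.+1%:R^-1 * p0l l ^+ (d - k)))
  (opow (OAdd (OConst (p0l l)) (OMul (OConst (-1)) (leaf i l))) k.+1).
pose lg i := osum (d * d.+1).+1 (fun l => osum d.+1 (inner i l)).
pose ex i := osum d.+1 (fun k => OMul (OConst (k`!%:R^-1)) (opow (lg i) k)).
pose e := OMul (OConst g.@[b])
  (osum (d * d.+1 * d).+1 (fun i => OMul (OConst (c1 i)) (ex i))).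
exists e.
  have s1 i l k : (k < d.+1)%N -> (osize (inner i l k) <= (d.+1 * 6 + 1) + 2)%N.
    by move=> kd; rewrite osize_scale -addn2 leq_add2r; apply: osize_opow.
  pose S2 := ((d * d.+1).+1 * (d.+1 * ((d.+1 * 6 + 1) + 2).+1 + 1).+1 + 1)%N.
  have s2 i : (osize (lg i) <= S2)%N.
    by apply: osize_osum => l _; apply: osize_osum => k; apply: s1.
  pose S3 := (d.+1 * ((d.+1 * S2.+1 + 1) + 2).+1 + 1)%N.
  have s3 i : (osize (ex i) <= S3)%N.
    apply: osize_osum => k kd.
    by rewrite osize_scale -addn2 leq_add2r; apply: osize_opow (s2 i) (ltnW kd).
  have s4 : (osize (osum (d * d.+1 * d).+1 (fun i => OMul (OConst (c1 i)) (ex i)))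
      <= (d * d.+1 * d).+1 * (S3 + 2).+1 + 1)%N.
    apply: osize_osum => i _.
    by rewrite osize_scale -addn2 leq_add2r.
  by rewrite /e osize_scale /obound -/S2 -/S3 -addn2 leq_add2r.
(* It is enough to compare values at each [x]. The direction [x - b] puts [b] at [t = 0] and [x] at
   [t = 1]; the expression was fixed before [x], because its coefficients depend on [b] alone. *)
apply: (mpoly_ext charF) => x; rewrite -/(oval f x e).
pose xi j := x j - b j.
have bE y : (line b xi y)`_0 = y.@[b].
  by rewrite -horner_coef0 horner_line; apply: meval_eq => i; rewrite mul0r addr0.
have pE : p`_0 = g by exact: shift_coef0.
have lpE : line b xi (lead_coef p) = cp%:P by rewrite lp lineC.
have lpqE : line b xi (lead_coef (p * q)) = c%:P by rewrite pq lf lineC.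
have sp : (size (line b xi (p`_0)%R) <= d.+1)%N.
  by rewrite pE; apply: leq_trans (size_line _ _ _) sg.
have spq : (size (bivar (line b xi) (p * q)%R) <= d.+1)%N.
  by rewrite pq; apply: leq_trans (size_bivar_shift _ _ _ _) sf.
have := H (line b xi) bE lpE lpqE sp spq.
rewrite pE pq !horner_line.
have -> : g.@[fun i => b i + 1 * xi i] = g.@[x].
  by apply: meval_eq => i; rewrite mul1r addrC subrK.
have -> : g.@[fun i => b i + 0 * xi i] = g.@[b].
  by apply: meval_eq => i; rewrite mul0r addr0.
move=> ->.
rewrite /e ovalM ovalC oval_sum; congr (_ * _); apply: eq_bigr => i _.
rewrite ovalM ovalC /texp horner_sum oval_sum; congr (_ * _); apply: eq_bigr => k _.
rewrite ovalM ovalC oval_pow hornerZ horner_exp; congr (_ * _ ^+ _).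
rewrite /lg oval_sum horner_sample_tlog; apply: eq_bigr => l _.
rewrite oval_sum; apply: eq_bigr => j _.
rewrite /inner ovalM ovalC oval_pow ovalD ovalM !ovalC oval_leaf mulN1r.
have -> : ((bivar (line b xi) (shift a f))`_0).[l%:R] = p0l l.
  by rewrite (@bivar_coef0 F _ (line b xi) (meval b)) // horner_shift.
have -> // : ((bivar (line b xi) (shift a f)).[i%:R%:P]).[l%:R] =
   f.@[fun j => i%:R * x j + (b j - i%:R * b j + l%:R * a j)].
rewrite /bivar horner_swapXY -map_poly_comp.
have -> : map_poly (horner_eval i%:R \o line b xi) (shift a f) =
          map_poly (meval (fun j => b j + i%:R * xi j)) (shift a f).
  by apply: eq_map_poly => y; rewrite /= /horner_eval horner_line.
rewrite horner_shift; apply: meval_eq => i'; rewrite /xi; ring.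
Qed.

(** * Polynomial growth *)

Section PolyIn.
Local Open Scope nat_scope.
Implicit Types s t u : nat -> nat.

Lemma leq_expn2r a b k : a <= b -> a ^ k <= b ^ k.
Proof. by move=> ab; case: k => // k; rewrite leq_exp2r. Qed.

(** A base of at least 2 absorbs additive constants, so closure under sums, products and composition
    becomes a matter of exponents. In the converse, [3 ^ k] covers the [n] with [s n <= 1]. *)
Lemma poly_inP s t : poly_in s t <-> exists k, forall n, t n <= (s n + 2) ^ k.
Proof.
split=> [[c Hc]|[k Hk]].
  exists c.+1 => n; apply: leq_trans (Hc n) _.
  have h1 : s n ^ c <= (s n + 2) ^ c by rewrite leq_expn2r ?leq_addr.
  have h2 : c <= (s n + 2) ^ c by rewrite ltnW // ltn_expl // addn2.
  by rewrite expnS; move: h1 h2; move: (_ ^ c) (_ ^ c) => x y; nia.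
exists (2 * k + 3 ^ k) => n; apply: leq_trans (Hk n) _.
case: (leqP (s n) 1) => [s1|s2].
  apply: (@leq_trans (3 ^ k)); first by rewrite leq_expn2r // -(addn2 1) leq_add2r.
  by rewrite addnA leq_addl.
apply: (@leq_trans (s n ^ (2 * k))).
  by rewrite expnM leq_expn2r // expnS expn1; nia.
apply: (@leq_trans (s n ^ (2 * k + 3 ^ k))); last exact: leq_addr.
by rewrite leq_pexp2l ?leq_addr // ltnW.
Qed.

Lemma poly_in_leq s t u : (forall n, t n <= u n) -> poly_in s u -> poly_in s t.
Proof. by move=> tu [c Hc]; exists c => n; apply: leq_trans (tu n) (Hc n). Qed.

Lemma poly_in_const s c : poly_in s (fun=> c).
Proof. by exists c => n; apply: leq_addl. Qed.

Lemma poly_inD s t u : poly_in s t -> poly_in s u -> poly_in s (fun n => t n + u n).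
Proof.
move=> /poly_inP [k Hk] /poly_inP [l Hl]; apply/poly_inP; exists (k + l).+1 => n.
have a0 : 0 < (s n + 2) ^ k by rewrite expn_gt0 addn2.
have b0 : 0 < (s n + 2) ^ l by rewrite expn_gt0 addn2.
rewrite expnS expnD; move: (Hk n) (Hl n) a0 b0.
by move: (_ ^ k) (_ ^ l) (t n) (u n) => x y z w; nia.
Qed.

Lemma poly_inM s t u : poly_in s t -> poly_in s u -> poly_in s (fun n => t n * u n).
Proof.
move=> /poly_inP [k Hk] /poly_inP [l Hl]; apply/poly_inP; exists (k + l) => n.
by rewrite expnD leq_mul.
Qed.

Lemma poly_inS s t : poly_in s t -> poly_in s (fun n => (t n).+1).
Proof.
move=> st; apply: (poly_in_leq (u := fun n => t n + 1)) => [n|].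
  by rewrite addn1.
exact/poly_inD/poly_in_const.
Qed.

Lemma poly_in_trans s t : poly_in s id -> poly_in id t -> poly_in s t.
Proof.
move=> /poly_inP [k Hk] /poly_inP [l Hl]; apply/poly_inP; exists ((k + 2) * l) => n.
apply: leq_trans (Hl n) _; rewrite expnM leq_expn2r //.
have a0 : 0 < (s n + 2) ^ k by rewrite expn_gt0 addn2.
have := Hk n; rewrite expnD (expnD _ 1 1) expn1.
by move: a0; move: (_ ^ k) => x; nia.
Qed.

Lemma poly_in_obound s t : poly_in s t -> poly_in s (fun n => obound (t n)).
Proof.
move=> st; rewrite /obound.
by repeat first [assumption | exact: poly_in_const | apply: poly_inD
  | apply: poly_inM | apply: poly_inS].
Qed.

(** This lets the size of the expression, polynomial in the degree and so in [n], be absorbed into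
    bounds polynomial in [n^(log n)]. *)
Lemma poly_in_n_pow_log_n : poly_in n_pow_log_n id.
Proof.
exists 1 => n; rewrite expn1 /n_pow_log_n.
case: n => [|[|n]] //; apply: leq_trans (leq_addr _ _).
by rewrite -{1}[n.+2]expn1 leq_pexp2l // trunc_log_gt0.
Qed.

End PolyIn.

(** * Transfer to the approximative closure *)

Lemma msize_leP (R : nzRingType) n (p : {mpoly R[n]}) k :
  reflect (forall m, m \in msupp p -> (mdeg m < k)%N) (msize p <= k)%N.
Proof.
rewrite msizeE; apply: (iffP (bigmax_leqP_seq _ _ _ _)) => H m.
  by move=> hm; apply: H.
by move=> hm _; apply: H.
Qed.

Lemma msize_map_leq (R S : nzRingType) n (phi : {additive R -> S}) (p : {mpoly R[n]}) :
  (msize (map_mpoly phi p) <= msize p)%N.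
Proof.
apply/msize_leP => m; rewrite mcoeff_msupp mcoeff_map_mpoly => nz.
apply: msize_mdeg_lt; rewrite mcoeff_msupp.
by apply: contraNneq nz => ->; rewrite raddf0.
Qed.

Lemma msize_map_inj (R S : nzRingType) n (phi : {rmorphism R -> S}) (p : {mpoly R[n]}) :
  injective phi -> msize (map_mpoly phi p) = msize p.
Proof.
move=> inj; rewrite !msizeE; apply: perm_big; exact: msupp_map_mpoly.
Qed.

Lemma map_mpoly_affine_subst (R S : comNzRingType) n (psi : {rmorphism R -> S})
    s b (p : {mpoly R[n]}) :
  map_mpoly psi (affine_subst s b p) =
  affine_subst (psi s) (psi \o b) (map_mpoly psi p).
Proof.
rewrite /affine_subst.
set lq := [tuple _ | i < n]; set lq' := [tuple _ | i < n].
apply: (@rmorph_mpoly_ext n R _ (map_mpoly psi \o comp_mpoly lq)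
  (comp_mpoly lq' \o map_mpoly psi)) => [c|i] /=.
  by rewrite comp_mpolyC !map_mpolyC comp_mpolyC.
rewrite map_mpolyX !comp_mpolyX -!/('X_i) /=.
transitivity (map_mpoly psi (tnth lq i)).
  by rewrite -comp_mpolyX comp_mpolyXU (tnth_nth 0).
transitivity (tnth lq' i).
  rewrite !tnth_mktuple rmorphD rmorphM /= !map_mpolyC map_mpolyX //.
by rewrite -comp_mpolyX comp_mpolyXU (tnth_nth 0).
Qed.

Lemma map_mpoly_oeval F (R S : comNzRingType) n (phi : F -> R)
    (psi : {rmorphism R -> S}) (p : {mpoly R[n]}) (e : oexpr F n) :
  map_mpoly psi (oeval phi p e) = oeval (psi \o phi) (map_mpoly psi p) e.
Proof.
elim: e => [c|s b|a IHa b IHb|a IHa b IHb] /=.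
- by rewrite map_mpolyC.
- by rewrite map_mpoly_affine_subst.
- by rewrite rmorphD /= IHa IHb.
- by rewrite rmorphM /= IHa IHb.
Qed.

Lemma eq_oeval F (R : comNzRingType) n (phi psi : F -> R) (p : {mpoly R[n]})
    (e : oexpr F n) : phi =1 psi -> oeval phi p e = oeval psi p e.
Proof.
move=> E; elim: e => [c|s b|a IHa b IHb|a IHa b IHb] /=.
- by rewrite E.
- rewrite /affine_subst E; congr (_ \mPo _); apply: eq_from_tnth => i.
  by rewrite !tnth_mktuple /= E.
- by rewrite IHa IHb.
- by rewrite IHa IHb.
Qed.

Section OevalDegree.
Variables (K : idomainType) (n : nat).
Implicit Types p q : {mpoly K[n]}.

Let mdegP p := (msize p).-1.

Lemma msizeD_pred p q : (mdegP (p + q) <= maxn (mdegP p) (mdegP q))%N.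
Proof.
have := msizeD_le p q; rewrite /mdegP.
move: (msize p) (msize q) (msize (p + q)) => x y z; lia.
Qed.

Lemma msizeM_pred p q : (mdegP (p * q) <= mdegP p + mdegP q)%N.
Proof.
case: (eqVneq p 0) => [->|p0]; first by rewrite mul0r /mdegP msize0.
case: (eqVneq q 0) => [->|q0]; first by rewrite mulr0 /mdegP msize0.
rewrite /mdegP msizeM //; move: (msize p) (msize q) => x y; lia.
Qed.

Lemma msize_affine_subst s b p : (msize (affine_subst s b p) <= msize p)%N.
Proof.
rewrite /affine_subst comp_mpolyEX; set lq := [tuple _ | i < n].
have lq2 i : (msize (tnth lq i) <= 2)%N.
  rewrite tnth_mktuple; apply: leq_trans (msizeD_le _ _) _.
  rewrite geq_max; apply/andP; split.
    by rewrite mul_mpolyC; apply: leq_trans (msizeZ_le _ _) _; rewrite msizeX mdeg1.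
  by rewrite msizeC; case: (_ == 0).
apply: leq_trans (msize_sum _ _ _) _; apply/bigmax_leqP_seq => m hm _.
apply: leq_trans (msizeZ_le _ _) _; rewrite comp_mpolyX.
apply: leq_trans (msize_mdeg_lt hm).
suff : (mdegP (\prod_(i < n) tnth lq i ^+ m i) <= mdeg m)%N.
  by rewrite /mdegP; move: (msize _) => x; lia.
rewrite mdegE; apply: (big_ind2 (fun q x => (mdegP q <= x)%N)) => [|q x q' x' hq hq'|i _].
- by rewrite /mdegP msize1.
- exact: leq_trans (msizeM_pred _ _) (leq_add hq hq').
elim: (m i) => [|k IHk]; first by rewrite expr0 /mdegP msize1.
rewrite exprS; apply: leq_trans (msizeM_pred _ _) _; rewrite -add1n leq_add //.
by move: (lq2 i); rewrite /mdegP; move: (msize _) => x; lia.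
Qed.

(** Every leaf has degree at most that of [p], and a tree multiplies at most as many leaves as it
    has nodes. *)
Lemma degree_oeval F (phi : F -> K) p (e : oexpr F n) :
  (mdegP (oeval phi p e) <= osize e * mdegP p)%N.
Proof.
elim: e => [c|s b|e1 IH1 e2 IH2|e1 IH1 e2 IH2] /=.
- by rewrite /mdegP msizeC; case: (_ == 0).
- by rewrite mul1n /mdegP; move: (msize_affine_subst (phi s) (phi \o b) p);
    move: (msize _) (msize _) => x y; lia.
- by apply: leq_trans (msizeD_pred _ _) _; move: IH1 IH2;
    move: (mdegP (oeval _ _ _)) (mdegP (oeval _ _ _)) => x y; nia.
- by apply: leq_trans (msizeM_pred _ _) _; move: IH1 IH2;
    move: (mdegP (oeval _ _ _)) (mdegP (oeval _ _ _)) => x y; nia.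
Qed.

End OevalDegree.

(* [comp p s]: the polynomial [p] is computed by a device of size at most [s]. *)
Record robust_measure (K : fieldType)
    (comp : forall n, {mpoly K[n]} -> nat -> Prop) (c0 : nat) : Prop := {
  robust_leq : forall n (p : {mpoly K[n]}) s t, (s <= t)%N -> comp n p s -> comp n p t;
  robust_const : forall n c, comp n c%:MP c0;
  robust_add : forall n (p q : {mpoly K[n]}) s t,
    comp n p s -> comp n q t -> comp n (p + q) (s + t + c0)%N;
  robust_mul : forall n (p q : {mpoly K[n]}) s t,
    comp n p s -> comp n q t -> comp n (p * q) (s + t + c0)%N;
  robust_subst : forall n (p : {mpoly K[n]}) s a b,
    comp n p s -> comp n (affine_subst a b p) (c0 * s + c0)%N
}.

Lemma robust_oeval (K : fieldType) comp c0 F (phi : F -> K) n (p : {mpoly K[n]}) s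
    (e : oexpr F n) : @robust_measure K comp c0 ->
  comp n p s -> comp n (oeval phi p e) (osize e * (c0 * s + c0 + c0))%N.
Proof.
move=> rob cp; elim: e => [c|a b|e1 IH1 e2 IH2|e1 IH1 e2 IH2] /=.
- by apply: (robust_leq rob) (robust_const rob _ _); rewrite mul1n leq_addl.
- by apply: (robust_leq rob) (robust_subst rob _ _ cp); rewrite mul1n leq_addr.
- by apply: (robust_leq rob) (robust_add rob IH1 IH2); nia.
- by apply: (robust_leq rob) (robust_mul rob IH1 IH2); nia.
Qed.

(** The bound [sz] is only required up to polynomial growth, so [comp] may be a device polynomially
    equivalent to the one defining the class, as happens for branching programs. *)
Definition measured (C : pclass) (K : fieldType) (s : nat -> nat)
    (comp : forall n, {mpoly K[n]} -> nat -> Prop) : Prop :=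
  forall f : poly_family K, C K f <->
    poly_degree f /\ exists2 sz : nat -> nat, poly_in s sz & forall n, comp n (f n) (sz n).

Section Transfer.
Variables (F : fieldType) (charF : [pchar F] =i pred0).
Variables (C : pclass) (s : nat -> nat).
Variables (comp : forall n, {mpoly (ratfun F)[n]} -> nat -> Prop) (c0 : nat).
Hypothesis s_id : poly_in s id.
Hypothesis comp_robust : robust_measure comp c0.
Hypothesis C_measured : measured C s comp.

Let inj_toR : injective (@tofrac {poly F}).
Proof. by move=> x y /eqP; rewrite tofrac_eq => /eqP. Qed.

(** The coefficients are kept in [F[eps]] rather than [F(eps)], so that [eps = 0] can be
    substituted. *)
Definition eps_family n (f : {mpoly F[n]}) t (fi : nat -> {mpoly F[n]}) :
    {mpoly {poly F}[n]} :=
  map_mpoly polyC f + \sum_(1 <= i < t.+1) 'X^i *: map_mpoly polyC (fi i).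

Lemma map_eps_family n (f : {mpoly F[n]}) t fi :
  map_mpoly (@tofrac {poly F}) (eps_family f t fi) =
  map_mpoly (@ratfun_const F) f +
  \sum_(1 <= i < t.+1) epsilon F ^+ i *: map_mpoly (@ratfun_const F) (fi i).
Proof.
have E (p : {mpoly F[n]}) :
    map_mpoly (@tofrac {poly F}) (map_mpoly polyC p) = map_mpoly (@ratfun_const F) p.
  pose phi : {rmorphism F -> {fraction {poly F}}} := (@tofrac {poly F} \o polyC).
  rewrite -[RHS]/(map_mpoly phi p); apply/mpolyP => m.
  by rewrite (mcoeff_map_mpoly phi) (mcoeff_map_mpoly (@tofrac _)) (mcoeff_map_mpoly polyC).
have mapD p q : map_mpoly (@tofrac {poly F}) (p + q) =
    map_mpoly (@tofrac {poly F}) p + map_mpoly (@tofrac {poly F}) q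
    :> {mpoly (ratfun F)[n]} by exact: rmorphD.
have mapZ c p : map_mpoly (@tofrac {poly F}) (c *: p) =
    tofrac c *: map_mpoly (@tofrac {poly F}) p
    :> {mpoly (ratfun F)[n]} by exact: map_mpolyZ.
have map0 : map_mpoly (@tofrac {poly F}) 0 = 0 :> {mpoly (ratfun F)[n]}.
  exact: rmorph0.
rewrite /eps_family mapD E; congr (_ + _).
elim: (index_iota 1 t.+1) => [|i r IHr]; first by rewrite !big_nil.
by rewrite !big_cons mapD IHr mapZ E /epsilon -tofracXn.
Qed.

Lemma eps_family0 n (f : {mpoly F[n]}) t fi :
  map_mpoly (horner_eval 0) (eps_family f t fi) = f.
Proof.
have E (p : {mpoly F[n]}) : map_mpoly (horner_eval 0) (map_mpoly polyC p) = p.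
  by apply/mpolyP => m; rewrite !mcoeff_map_mpoly /= /horner_eval hornerC.
have mapD (p q : {mpoly {poly F}[n]}) : map_mpoly (horner_eval 0) (p + q) =
    map_mpoly (horner_eval 0) p + map_mpoly (horner_eval 0) q by exact: rmorphD.
rewrite /eps_family mapD E -[RHS]addr0; congr (_ + _).
rewrite big_add1 /=; elim: (index_iota 0 t) => [|i r IHr].
  by rewrite big_nil; exact: rmorph0.
rewrite big_cons mapD IHr addr0 map_mpolyZ /= /horner_eval hornerXn expr0n.
by rewrite scale0r.
Qed.

(** Splitting the coefficients by powers of [eps] gives any polynomial over [F[eps]] the shape
    demanded by the closure; [t] bounds all degrees in [eps]. *)
Lemma eps_familyP n (p : {mpoly {poly F}[n]}) :
  exists t fi, p = eps_family (map_mpoly (horner_eval 0) p) t fi.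
Proof.
pose t := (\max_(m <- msupp p) size (p@_m)%R)%N.
exists t, (fun i => map_mpoly (coefp i) p).
apply/mpolyP => m; rewrite /eps_family mcoeffD !mcoeff_map_mpoly raddf_sum /=.
apply/polyP => k; rewrite coefD coefC coef_sum /= /horner_eval horner_coef0.
have Ei i : ('X^i *: map_mpoly polyC (map_mpoly (coefp i) p))@_m`_k =
    if k == i then (p@_m)`_i else 0.
  rewrite mcoeffZ !mcoeff_map_mpoly /= mulrC mul_polyC coefZ coefXn.
  by case: (k == i); rewrite ?mulr1 ?mulr0.
under eq_bigr => i _ do rewrite Ei.
rewrite -big_mkcond /= {Ei}; case: k => [|k] /=.
  by rewrite big_nat_cond big1 ?addr0 // => -[|i] //; rewrite andbF.
rewrite add0r; case: (ltnP k t) => [kt|tk].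
  rewrite (big_rem k.+1) /= ?mem_index_iota ?kt // eqxx big_seq_cond big1 ?addr0 //.
  move=> i /andP [hi /eqP ki]; move: hi; rewrite -ki.
  by rewrite mem_rem_uniq ?iota_uniq // inE eqxx.
have -> : (p@_m)`_k.+1 = 0.
  apply: nth_default; apply: leq_trans (leqW tk).
  case: (boolP (m \in msupp p)) => [hm|/memN_msupp_eq0 ->]; last by rewrite size_poly0.
  by rewrite /t (big_rem m) //= leq_maxl.
rewrite big_nat_cond big1 // => i /andP [/andP [_ hi] /eqP ki].
by move: hi; rewrite -ki ltnS ltnNge tk.
Qed.

(** The expression produced for [f] over [F] is evaluated at the approximation of [f]. Setting
    [eps = 0] commutes with the evaluation, so the result approximates [g]; embedding into [F(eps)]
    commutes with it too, so [comp_robust] bounds its size. *)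
Theorem closed_under_factors_transfer :
  closed_under_factors (@approx_closure C F).
Proof.
move=> f g [t [fi /C_measured [degA [sz sz_poly compA]]]] fac.
pose A n := map_mpoly (@tofrac {poly F}) (eps_family (f n) (t n) (fi n)).
have AE n := map_eps_family (f n) (t n) (fi n).
(* The class bounds the degree of the approximation, and setting [eps = 0] cannot raise it, so [d]
   also bounds the degree of [f]. *)
pose d n := (msize (A n)).-1.
have d_poly : poly_in id d.
  by apply: poly_in_leq degA => n; rewrite /d /A AE.
have ex_e n : exists e : oexpr F n,
    (osize e <= obound (d n))%N /\ oeval id (f n) e = g n.
  have [h h0 E] := fac n.
  have [|e he ge] := @factor_oexpr F charF n _ _ _ (d n) h0 E; last by exists e.
  apply: leq_trans (leqSpred _).
  rewrite /A msize_map_inj // -{1}(eps_family0 (f n) (t n) (fi n)).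
  exact: msize_map_leq.
pose e n := proj1_sig (constructive_indefinite_description _ (ex_e n)).
have se n : (osize (e n) <= obound (d n))%N.
  by rewrite /e; case: (constructive_indefinite_description _ _) => ? /= [].
have ge n : oeval id (f n) (e n) = g n.
  by rewrite /e; case: (constructive_indefinite_description _ _) => ? /= [].
pose Gh n := oeval polyC (eps_family (f n) (t n) (fi n)) (e n).
have Gh0 n : map_mpoly (horner_eval 0) (Gh n) = g n.
  rewrite /Gh map_mpoly_oeval eps_family0 -ge; apply: eq_oeval => c.
  by rewrite /= /horner_eval hornerC.
have ex_t n : exists ti : nat * (nat -> {mpoly F[n]}),
    Gh n = eps_family (g n) ti.1 ti.2.
  by have [t' [fi' E]] := eps_familyP (Gh n); exists (t', fi'); rewrite /= -Gh0.
pose ti n := proj1_sig (constructive_indefinite_description _ (ex_t n)).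
have tiE n : Gh n = eps_family (g n) (ti n).1 (ti n).2.
  by rewrite /ti; case: (constructive_indefinite_description _ _).
exists (fun n => (ti n).1), (fun n => (ti n).2); apply/C_measured.
have BE n : map_mpoly (@ratfun_const F) (g n) +
    \sum_(1 <= i < (ti n).1.+1)
      epsilon F ^+ i *: map_mpoly (@ratfun_const F) ((ti n).2 i) =
    oeval (@ratfun_const F) (A n) (e n).
  by rewrite -map_eps_family -tiE /Gh map_mpoly_oeval.
split.
  apply: (poly_in_leq (u := fun n => obound (d n) * d n)%N) => [n|].
    rewrite BE; apply: leq_trans (degree_oeval _ _ _) _.
    by rewrite leq_mul2r se orbT.
  by apply: poly_inM => //; apply: poly_in_obound.
exists (fun n => obound (d n) * (c0 * sz n + c0 + c0))%N => [|n].
  apply: poly_inM; first by apply: poly_in_trans => //; apply: poly_in_obound.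
  apply: poly_inD; last exact: poly_in_const.
  apply: poly_inD; last exact: poly_in_const.
  by apply: poly_inM => //; apply: poly_in_const.
have cA : comp (A n) (sz n) by rewrite /A AE; apply: compA.
rewrite BE; apply: (robust_leq comp_robust _
  (robust_oeval (@ratfun_const F) (e n) comp_robust cA)).
by rewrite leq_mul2r se orbT.
Qed.

End Transfer.

Lemma affine_substC (K : comNzRingType) n s b c :
  affine_subst s b c%:MP = c%:MP :> {mpoly K[n]}.
Proof. exact: comp_mpolyC. Qed.

Lemma affine_substX (K : comNzRingType) n s b i :
  affine_subst s b 'X_i = s%:MP * 'X_i + (b i)%:MP :> {mpoly K[n]}.
Proof.
by rewrite /affine_subst comp_mpolyXU -tnth_nth tnth_mktuple.
Qed.

HB.instance Definition _ (K : comNzRingType) n (s : K) (b : 'I_n -> K) :=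
  GRing.RMorphism.copy (affine_subst s b)
    (comp_mpoly [tuple s%:MP * 'X_i + (b i)%:MP | i < n]).

(** * Formulas *)

Section Formulas.
Variable K : fieldType.

Definition formula_comp n (p : {mpoly K[n]}) (s : nat) : Prop :=
  exists2 e : formula K n, (formula_size e <= s)%N & formula_poly e = p.

Fixpoint formula_subst n (a : K) (b : 'I_n -> K) (e : formula K n) : formula K n :=
  match e with
  | FVar i => FAdd (FMul (FConst n a) (FVar K i)) (FConst n (b i))
  | FConst c => FConst n c
  | FAdd x y => FAdd (formula_subst a b x) (formula_subst a b y)
  | FMul x y => FMul (formula_subst a b x) (formula_subst a b y)
  end.

Lemma formula_substP n a b (e : formula K n) :
  (formula_size (formula_subst a b e) <= 5 * formula_size e)%N /\
  formula_poly (formula_subst a b e) = affine_subst a b (formula_poly e).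
Proof.
elim: e => [i|c|x [sx ex] y [sy ey]|x [sx ex] y [sy ey]] /=.
- by rewrite affine_substX.
- by rewrite affine_substC.
- by rewrite ex ey rmorphD; split=> //; lia.
- by rewrite ex ey rmorphM; split=> //; lia.
Qed.

(** The constant 5 is the size of the formula [a x_i + b_i] that replaces a variable. *)
Lemma formula_robust : robust_measure formula_comp 5.
Proof.
split=> [n p s t st [e he <-]|n c|n p q s t [x hx <-] [y hy <-]
        |n p q s t [x hx <-] [y hy <-]|n p s a b [e he <-]].
- by exists e => //; apply: leq_trans he st.
- by exists (FConst n c).
- by exists (FAdd x y) => //=; lia.
- by exists (FMul x y) => //=; lia.
have [h1 h2] := formula_substP a b e.
by exists (formula_subst a b e) => //; lia.
Qed.

Lemma VF_measured s : measured (VF s) s formula_comp.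
Proof.
move=> f; split=> -[df].
  by case=> e se fe; split=> //; exists (fun n => formula_size (e n)) => // n; exists (e n).
case=> sz hsz comp_f; split=> //.
have ex n : exists e, (formula_size e <= sz n)%N /\ formula_poly e = f n.
  by have [e h1 h2] := comp_f n; exists e.
pose e n := proj1_sig (constructive_indefinite_description _ (ex n)).
have eP n : (formula_size (e n) <= sz n)%N /\ formula_poly (e n) = f n.
  by rewrite /e; case: (constructive_indefinite_description _ _).
exists e => [|n]; last by case: (eP n).
by apply: poly_in_leq hsz => n; case: (eP n).
Qed.

End Formulas.

(** * Circuits as straight-line programs *)

Section StraightLine.
Variable K : fieldType.

Section Fixed.
Variable n : nat.
Implicit Types (vs ws : seq {mpoly K[n]}) (p : {mpoly K[n]}).

Definition slp_step vs p : Prop :=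
  [\/ exists i, p = 'X_i, exists c, p = c%:MP
    | exists a b, [/\ a \in vs, b \in vs & p = a + b \/ p = a * b]].

(* The values of the gates of a circuit, the last gate first. *)
Inductive slp : seq {mpoly K[n]} -> Prop :=
| slp_nil : slp [::]
| slp_cons vs p of slp vs & slp_step vs p : slp (p :: vs).

Lemma slp_step_sub vs ws p : {subset vs <= ws} -> slp_step vs p -> slp_step ws p.
Proof.
move=> sub [h|h|[a [b [ha hb E]]]]; [exact: Or31|exact: Or32|apply: Or33].
by exists a, b; split=> //; apply: sub.
Qed.

Lemma slp_cat vs ws : slp vs -> slp ws -> slp (vs ++ ws).
Proof.
move=> hvs hws; elim: hvs => //= {}vs p _ IH st; apply: slp_cons => //.
by apply: slp_step_sub st => x; rewrite mem_cat => ->.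
Qed.

Lemma slp_suffix vs ws : slp (vs ++ ws) -> slp ws.
Proof. by elim: vs => //= p vs IH h; apply: IH; inversion h. Qed.

Lemma circuit_polys_rcons (C : circuit K n) g :
  circuit_polys (rcons C g) =
  rcons (circuit_polys C) (gate_poly (circuit_polys C) g).
Proof. by rewrite /circuit_polys foldl_rcons. Qed.

Lemma size_circuit_polys (C : circuit K n) : size (circuit_polys C) = size C.
Proof.
by elim/last_ind: C => // C g IH; rewrite circuit_polys_rcons !size_rcons IH.
Qed.

Lemma circuit_wfE (C : circuit K n) : circuit_wf C <->
  (0 < size C)%N /\
  forall k, (k < size C)%N -> gate_wf k (nth (GConst n 0) C k).
Proof.
rewrite /circuit_wf; split=> [/andP [h0 /forallP h]|[h0 h]].
  split=> // k hk; have := h (Ordinal hk).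
  by rewrite (tnth_nth (GConst n 0)).
rewrite h0; apply/forallP => k; rewrite (tnth_nth (GConst n 0)); exact: h.
Qed.

Lemma slp_of_circuit (C : circuit K n) :
  (forall k, (k < size C)%N -> gate_wf k (nth (GConst n 0) C k)) ->
  slp (rev (circuit_polys C)).
Proof.
elim/last_ind: C => [|C g IH] wf; first exact: slp_nil.
rewrite circuit_polys_rcons rev_rcons; apply: slp_cons.
  apply: IH => k hk; have := wf k; rewrite size_rcons nth_rcons hk.
  by apply; apply: ltnW.
have := wf (size C); rewrite size_rcons nth_rcons ltnn eqxx ltnSn => /(_ isT).
have memC k : (k < size C)%N -> (circuit_polys C)`_k \in rev (circuit_polys C).
  by move=> hk; rewrite mem_rev mem_nth // size_circuit_polys.
case: g {wf} => [i|c|i j|i j] /=.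
- by move=> _; apply: Or31; exists i.
- by move=> _; apply: Or32; exists c.
- case/andP=> hi hj; apply: Or33; do 2 eexists; split; [exact: memC hi|exact: memC hj|by left].
- case/andP=> hi hj; apply: Or33; do 2 eexists; split; [exact: memC hi|exact: memC hj|by right].
Qed.

Lemma circuit_of_slp vs : slp vs -> exists C : circuit K n,
  circuit_polys C = rev vs /\
  (forall k, (k < size C)%N -> gate_wf k (nth (GConst n 0) C k)).
Proof.
elim=> [|{}vs p _ [C [EC wf]] st]; first by exists [::].
have sC : size C = size vs by rewrite -size_circuit_polys EC size_rev.
have [g [wg pg]] : exists g, gate_wf (size C) g /\ gate_poly (circuit_polys C) g = p.
  have idx a : a \in vs -> (index a (rev vs) < size C)%N /\ (rev vs)`_(index a (rev vs)) = a.
    by move=> ha; rewrite sC -(size_rev vs) index_mem mem_rev nth_index // mem_rev.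
  case: st => [[i ->]|[c ->]|[a [b [/idx [ha1 ha2] /idx [hb1 hb2] [->|->]]]]].
  - by exists (GVar K i).
  - by exists (GConst n c).
  - by exists (GAdd K n (index a (rev vs)) (index b (rev vs))); rewrite /= ha1 hb1 EC ha2 hb2.
  - by exists (GMul K n (index a (rev vs)) (index b (rev vs))); rewrite /= ha1 hb1 EC ha2 hb2.
exists (rcons C g); rewrite circuit_polys_rcons pg EC rev_cons; split=> // k.
rewrite size_rcons ltnS leq_eqVlt nth_rcons => /orP [/eqP ->|hk].
  by rewrite ltnn eqxx.
by rewrite hk; apply: wf.
Qed.

Definition slp_comp p s : Prop :=
  exists vs, [/\ slp vs, p \in vs & (size vs <= s)%N].

Lemma slp_comp_circuit (C : circuit K n) :
  circuit_wf C -> slp_comp (circuit_poly C) (size C).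
Proof.
move/circuit_wfE=> [C0 wf]; exists (rev (circuit_polys C)); split.
- exact: slp_of_circuit.
- rewrite mem_rev /circuit_poly; move: C0; rewrite -size_circuit_polys.
  by case: (circuit_polys C) => //= x l _; apply: mem_last.
by rewrite size_rev size_circuit_polys.
Qed.

(** The value [p] may occur anywhere in the program; the gates after it are cut off to make it the
    output. *)
Lemma circuit_slp_comp p s : slp_comp p s -> exists C : circuit K n,
  [/\ circuit_wf C, (size C <= s)%N & circuit_poly C = p].
Proof.
case=> vs [hvs pvs svs]; case/splitPr: pvs hvs svs => v1 v2 hvs svs.
have [C [EC wf]] := circuit_of_slp (slp_suffix hvs).
have sC : size C = (size v2).+1 by rewrite -size_circuit_polys EC size_rev.
exists C; split.
- by apply/circuit_wfE; rewrite sC in wf *.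
- by rewrite sC; apply: leq_trans svs; rewrite size_cat leq_addl.
by rewrite /circuit_poly EC rev_cons last_rcons.
Qed.

Lemma slp_comp_leq p s t : (s <= t)%N -> slp_comp p s -> slp_comp p t.
Proof. by move=> st [vs [h1 h2 h3]]; exists vs; split=> //; apply: leq_trans st. Qed.

Lemma slp_compC c : slp_comp c%:MP 1.
Proof.
exists [:: c%:MP]; split=> //; last by rewrite inE.
by apply: slp_cons; [exact: slp_nil | apply: Or32; exists c].
Qed.

Lemma slp_compX i : slp_comp 'X_i 1.
Proof.
exists [:: 'X_i]; split=> //; last by rewrite inE.
by apply: slp_cons; [exact: slp_nil | apply: Or31; exists i].
Qed.

Lemma slp_compD p q s t : slp_comp p s -> slp_comp q t -> slp_comp (p + q) (s + t + 1).
Proof.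
move=> [vs [h1 h2 h3]] [ws [k1 k2 k3]]; exists (p + q :: vs ++ ws); split.
- apply: slp_cons; first exact: slp_cat.
  by apply: Or33; exists p, q; rewrite !mem_cat h2 k2 orbT; split=> //; left.
- by rewrite inE eqxx.
by rewrite /= size_cat addn1 ltnS leq_add.
Qed.

Lemma slp_compM p q s t : slp_comp p s -> slp_comp q t -> slp_comp (p * q) (s + t + 1).
Proof.
move=> [vs [h1 h2 h3]] [ws [k1 k2 k3]]; exists (p * q :: vs ++ ws); split.
- apply: slp_cons; first exact: slp_cat.
  by apply: Or33; exists p, q; rewrite !mem_cat h2 k2 orbT; split=> //; right.
- by rewrite inE eqxx.
by rewrite /= size_cat addn1 ltnS leq_add.
Qed.

End Fixed.

(** An input gate is replaced by a program of size at most [d]; constants and operations cost one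
    gate each because [phi] is a ring morphism. *)
Lemma slp_comp_morph n k (phi : {rmorphism {mpoly K[n]} -> {mpoly K[k]}}) d p s :
  (0 < d)%N -> (forall c, phi c%:MP = c%:MP) ->
  (forall i, slp_comp (phi 'X_i) d) ->
  slp_comp p s -> slp_comp (phi p) (d * s).
Proof.
move=> d0 phiC phiX [vs [hvs pvs svs]].
suff [ws [h1 h2 h3]] : exists ws, [/\ slp ws, {subset [seq phi v | v <- vs] <= ws}
    & (size ws <= d * size vs)%N].
  exists ws; split=> //; first by apply: h2; apply: map_f.
  by apply: leq_trans h3 _; rewrite leq_mul2l svs orbT.
elim: hvs => [|{}vs {pvs svs}q _ [ws [h1 h2 h3]] st].
  by exists [::]; split=> //; apply: slp_nil.
have ext us : slp (us ++ ws) -> phi q \in us ++ ws -> (size us <= d)%N ->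
    exists ws0, [/\ slp ws0, {subset [seq phi v | v <- q :: vs] <= ws0}
      & (size ws0 <= d * size (q :: vs))%N].
  move=> hs hq su; exists (us ++ ws); split=> //.
    by move=> x; rewrite inE => /orP [/eqP -> //|/h2 hx]; rewrite mem_cat hx orbT.
  by rewrite size_cat /= mulnS leq_add.
case: st => [[i Eq]|[c Eq]|[a [b [ha hb Eq]]]].
- have [us [k1 k2 k3]] := phiX i; apply: (ext us) => //; first exact: slp_cat.
  by rewrite mem_cat Eq k2.
- apply: (ext [:: phi q]); rewrite ?inE ?eqxx //=.
  by apply: slp_cons => //; apply: Or32; exists c; rewrite Eq phiC.
apply: (ext [:: phi q]); rewrite ?inE ?eqxx //=.
apply: slp_cons => //; apply: Or33; exists (phi a), (phi b).
split; [by apply: h2; apply: map_f|by apply: h2; apply: map_f|].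
by case: Eq => ->; rewrite ?rmorphD ?rmorphM; [left|right].
Qed.

End StraightLine.

(** * Exponential sums *)

Section BitSums.
Variable K : fieldType.
Hypothesis two_neq0 : (2%:R : K) != 0.

Definition bits n t (w : t.-tuple bool) (h : {mpoly K[n + t]}) := subst_bits h w.
HB.instance Definition _ n t (w : t.-tuple bool) :=
  GRing.RMorphism.copy (@bits n t w)
    (comp_mpoly [tuple match split i with
                | inl j => 'X_j
                | inr j => ((tnth w j)%:R)%:MP
                end | i < n + t]).

Lemma subst_bitsC n t c w : @subst_bits K n t c%:MP w = c%:MP.
Proof. exact: comp_mpolyC. Qed.

Lemma subst_bitsX n t i w : @subst_bits K n t 'X_i w =
  match split i with inl j => 'X_j | inr j => ((tnth w j)%:R)%:MP end.
Proof.
by rewrite /subst_bits comp_mpolyXU -tnth_nth tnth_mktuple.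
Qed.

Definition bitsum_comp n (p : {mpoly K[n]}) (s : nat) : Prop :=
  exists t (h : {mpoly K[n + t]}), [/\ (t <= s)%N, slp_comp h s
    & p = \sum_(w : t.-tuple bool) subst_bits h w].

Lemma sum_cat_tuple (V : nmodType) t1 t2 (E : (t1 + t2).-tuple bool -> V) :
  \sum_w E w = \sum_(w1 : t1.-tuple bool) \sum_(w2 : t2.-tuple bool) E (cat_tuple w1 w2).
Proof.
rewrite pair_big /= (reindex (fun w : t1.-tuple bool * t2.-tuple bool => cat_tuple w.1 w.2)) //=.
exists (fun w => ([tuple tnth w (lshift t2 i) | i < t1], [tuple tnth w (rshift t1 i) | i < t2])).
  move=> [w1 w2] _ /=; congr (_, _); apply: eq_from_tnth => i.
    by rewrite tnth_mktuple tnth_lshift.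
  by rewrite tnth_mktuple tnth_rshift.
move=> w _; apply: eq_from_tnth => i /=; case: (split_ordP i) => j ->.
  by rewrite tnth_lshift tnth_mktuple.
by rewrite tnth_rshift tnth_mktuple.
Qed.

Definition widen_left n t1 t2 : {mpoly K[n + t1]} -> {mpoly K[n + (t1 + t2)]} :=
  comp_mpoly [tuple match split i with
    | inl j => 'X_(lshift (t1 + t2) j)
    | inr j => 'X_(rshift n (lshift t2 j)) end | i < n + t1].
HB.instance Definition _ n t1 t2 :=
  GRing.RMorphism.copy (@widen_left n t1 t2) (@widen_left n t1 t2).

Definition widen_right n t1 t2 : {mpoly K[n + t2]} -> {mpoly K[n + (t1 + t2)]} :=
  comp_mpoly [tuple match split i with
    | inl j => 'X_(lshift (t1 + t2) j)
    | inr j => 'X_(rshift n (rshift t1 j)) end | i < n + t2].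
HB.instance Definition _ n t1 t2 :=
  GRing.RMorphism.copy (@widen_right n t1 t2) (@widen_right n t1 t2).

Lemma widen_leftX n t1 t2 i : @widen_left n t1 t2 'X_i =
  match split i with
  | inl j => 'X_(lshift (t1 + t2) j) | inr j => 'X_(rshift n (lshift t2 j)) end.
Proof. by rewrite /widen_left comp_mpolyXU -tnth_nth tnth_mktuple. Qed.

Lemma widen_rightX n t1 t2 i : @widen_right n t1 t2 'X_i =
  match split i with
  | inl j => 'X_(lshift (t1 + t2) j) | inr j => 'X_(rshift n (rshift t1 j)) end.
Proof. by rewrite /widen_right comp_mpolyXU -tnth_nth tnth_mktuple. Qed.

Lemma subst_bits_left n t1 t2 (h : {mpoly K[n + t1]}) w1 w2 :
  subst_bits (widen_left t2 h) (cat_tuple w1 w2) = subst_bits h w1.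
Proof.
apply: (@rmorph_mpoly_ext _ _ _
  (@bits n (t1 + t2) (cat_tuple w1 w2) \o @widen_left n t1 t2)
  (@bits n t1 w1)) => [c|i]; rewrite /= /bits.
  by rewrite /widen_left comp_mpolyC !subst_bitsC.
rewrite widen_leftX [RHS]subst_bitsX; case: (split i) => j; rewrite subst_bitsX.
  by rewrite (unsplitK (inl j)).
by rewrite (unsplitK (inr _)) tnth_lshift.
Qed.

Lemma subst_bits_right n t1 t2 (h : {mpoly K[n + t2]}) w1 w2 :
  subst_bits (widen_right t1 h) (cat_tuple w1 w2) = subst_bits h w2.
Proof.
apply: (@rmorph_mpoly_ext _ _ _
  (@bits n (t1 + t2) (cat_tuple w1 w2) \o @widen_right n t1 t2)
  (@bits n t2 w2)) => [c|i]; rewrite /= /bits.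
  by rewrite /widen_right comp_mpolyC !subst_bitsC.
rewrite widen_rightX [RHS]subst_bitsX; case: (split i) => j; rewrite subst_bitsX.
  by rewrite (unsplitK (inl j)).
by rewrite (unsplitK (inr _)) tnth_rshift.
Qed.

Lemma slp_widen_left n t1 t2 (h : {mpoly K[n + t1]}) s :
  slp_comp h s -> slp_comp (widen_left t2 h) s.
Proof.
rewrite -{2}[s]mul1n; apply: (@slp_comp_morph K _ _ (@widen_left n t1 t2)) => //.
  by move=> c; apply: comp_mpolyC.
by move=> i /=; rewrite widen_leftX; case: (split i) => j; apply: slp_compX.
Qed.

Lemma slp_widen_right n t1 t2 (h : {mpoly K[n + t2]}) s :
  slp_comp h s -> slp_comp (widen_right t1 h) s.
Proof.
rewrite -{2}[s]mul1n; apply: (@slp_comp_morph K _ _ (@widen_right n t1 t2)) => //.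
  by move=> c; apply: comp_mpolyC.
by move=> i /=; rewrite widen_rightX; case: (split i) => j; apply: slp_compX.
Qed.

(** The factors read disjoint blocks of bits, so the product of the two sums is the sum of the
    products. *)
Lemma bitsum_compM n (p q : {mpoly K[n]}) s t :
  bitsum_comp p s -> bitsum_comp q t -> bitsum_comp (p * q) (s + t + 5).
Proof.
move=> [t1 [h1 [ts1 c1 ->]]] [t2 [h2 [ts2 c2 ->]]].
exists (t1 + t2)%N, (widen_left t2 h1 * widen_right t1 h2); split; first by lia.
  apply: slp_comp_leq (slp_compM (slp_widen_left _ c1) (slp_widen_right _ c2)); lia.
rewrite sum_cat_tuple mulr_suml; apply: eq_bigr => w1 _.
rewrite mulr_sumr; apply: eq_bigr => w2 _.
rewrite -(subst_bits_left h1 w1 w2) -(subst_bits_right h2 w1 w2).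
by rewrite -[RHS]/(bits _ _) rmorphM.
Qed.

Lemma sum_const_bits n t (c : {mpoly K[n]}) :
  \sum_(w : t.-tuple bool) ((2%:R ^+ t)^-1)%:MP * c = c.
Proof.
rewrite sumr_const card_tuple card_bool -[LHS]mulr_natl mulrA.
have -> : (2 ^ t)%:R = ((2%:R ^+ t)%:MP : {mpoly K[n]}).
  by rewrite natrX rmorphXn rmorph_nat.
by rewrite -mpolyCM divff ?expf_neq0 // mul1r.
Qed.

(* The sum of two exponential sums is averaged over the bits of the other one. *)
Lemma bitsum_compD n (p q : {mpoly K[n]}) s t :
  bitsum_comp p s -> bitsum_comp q t -> bitsum_comp (p + q) (s + t + 5).
Proof.
move=> [t1 [h1 [ts1 c1 ->]]] [t2 [h2 [ts2 c2 ->]]].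
exists (t1 + t2)%N, (((2%:R ^+ t2)^-1)%:MP * widen_left t2 h1 +
  ((2%:R ^+ t1)^-1)%:MP * widen_right t1 h2); split; first by lia.
  apply: slp_comp_leq (slp_compD (slp_compM (slp_compC _ _) (slp_widen_left _ c1))
    (slp_compM (slp_compC _ _) (slp_widen_right _ c2))); lia.
have sbE w1 w2 : subst_bits (((2%:R ^+ t2)^-1)%:MP * widen_left t2 h1 +
    ((2%:R ^+ t1)^-1)%:MP * widen_right t1 h2) (cat_tuple w1 w2) =
    ((2%:R ^+ t2)^-1)%:MP * subst_bits h1 w1 + ((2%:R ^+ t1)^-1)%:MP * subst_bits h2 w2.
  rewrite -(subst_bits_left h1 w1 w2) -(subst_bits_right h2 w1 w2).
  rewrite -[LHS]/(bits _ _) rmorphD !rmorphM /= /bits.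
  by rewrite !subst_bitsC.
rewrite sum_cat_tuple; transitivity (\sum_(w1 : t1.-tuple bool)
    (\sum_(w2 : t2.-tuple bool) ((2%:R ^+ t2)^-1)%:MP * subst_bits h1 w1 +
     \sum_(w2 : t2.-tuple bool) ((2%:R ^+ t1)^-1)%:MP * subst_bits h2 w2)); last first.
  by apply: eq_bigr => w1 _; rewrite -big_split; apply: eq_bigr => w2 _; rewrite sbE.
rewrite big_split /=; congr (_ + _).
  by apply: eq_bigr => w1 _; rewrite sum_const_bits.
by rewrite [RHS]exchange_big /=; apply: eq_bigr => w2 _; rewrite sum_const_bits.
Qed.

Definition extend_affine n t (a : K) (b : 'I_n -> K) :
    {mpoly K[n + t]} -> {mpoly K[n + t]} :=
  comp_mpoly [tuple match split i with
    | inl j => a%:MP * 'X_(lshift t j) + (b j)%:MP | inr j => 'X_(rshift n j) end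
    | i < n + t].
HB.instance Definition _ n t a b :=
  GRing.RMorphism.copy (@extend_affine n t a b) (@extend_affine n t a b).

(** The substitution is applied to the first [n] variables of the verifier only, hence it commutes
    with fixing the bits. *)
Lemma bitsum_comp_subst n (p : {mpoly K[n]}) s a b :
  bitsum_comp p s -> bitsum_comp (affine_subst a b p) (5 * s + 5).
Proof.
move=> [t [h [ts ch ->]]].
have eaX i : extend_affine a b 'X_i = match split i with
    | inl j => a%:MP * 'X_(lshift t j) + (b j)%:MP | inr j => 'X_(rshift n j) end.
  by rewrite /extend_affine comp_mpolyXU -tnth_nth tnth_mktuple.
exists t, (extend_affine a b h); split; first by lia.
  apply: (@slp_comp_leq _ _ _ (5 * s)); first by rewrite leq_addr.
  apply: (@slp_comp_morph K _ _ (@extend_affine n t a b)) => //.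
    by move=> c; apply: comp_mpolyC.
  move=> i /=; rewrite eaX; case: (split i) => j.
    apply: slp_comp_leq (slp_compD (slp_compM (slp_compC _ _) (slp_compX _ _)) (slp_compC _ _)).
    by [].
  by apply: slp_comp_leq (slp_compX _ _).
rewrite (raddf_sum (affine_subst a b)) /=; apply: eq_bigr => w _.
apply: (@rmorph_mpoly_ext _ _ _ (affine_subst a b \o @bits n t w)
  (@bits n t w \o @extend_affine n t a b)) => [c|i]; rewrite /= /bits.
  by rewrite /extend_affine comp_mpolyC !subst_bitsC affine_substC.
rewrite eaX subst_bitsX; case: (split i) => j.
  rewrite affine_substX -[RHS]/(bits w _) rmorphD rmorphM /= /bits.
  by rewrite !subst_bitsC subst_bitsX (unsplitK (inl j)).
by rewrite affine_substC subst_bitsX (unsplitK (inr j)).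
Qed.

(** The additive 5 comes from the averaged sum: two constants, two products and one addition. *)
Lemma bitsum_robust : robust_measure bitsum_comp 5.
Proof.
split; last 1 first.
- exact: bitsum_comp_subst.
- move=> n p s t st [t1 [h [h1 h2 h3]]]; exists t1, h; split=> //.
    exact: leq_trans st.
  exact: slp_comp_leq h2.
- move=> n c; exists 0%N, c%:MP; split=> //; first exact: slp_comp_leq (slp_compC _ _).
  by under eq_bigr => w _ do rewrite subst_bitsC; rewrite sumr_const card_tuple expn0.
- exact: bitsum_compD.
- exact: bitsum_compM.
Qed.

Lemma VNP_measured s : measured (VNP s) s bitsum_comp.
Proof.
move=> f; split=> -[df].
  case=> t [C [tp wf sp fE]]; split=> //; exists (fun n => t n + size (C n))%N => [|n].
    exact: poly_inD.
  exists (t n), (circuit_poly (C n)); split=> //; first exact: leq_addr.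
  by apply: slp_comp_leq (slp_comp_circuit (wf n)); rewrite leq_addl.
case=> sz hsz comp_f; split=> //.
have ex n : exists tC : {t : nat & circuit K (n + t)}, [/\ (projT1 tC <= sz n)%N,
    circuit_wf (projT2 tC), (size (projT2 tC) <= sz n)%N &
    f n = \sum_(w : (projT1 tC).-tuple bool) subst_bits (circuit_poly (projT2 tC)) w].
  have [t [h [h1 h2 ->]]] := comp_f n.
  have [C [C1 C2 C3]] := circuit_slp_comp h2.
  by exists (existT _ t C) => /=; rewrite C3.
pose e n := proj1_sig (constructive_indefinite_description _ (ex n)).
have eP n := proj2_sig (constructive_indefinite_description _ (ex n)).
exists (fun n => projT1 (e n)), (fun n => projT2 (e n)); split=> [|n||n].
- by apply: poly_in_leq hsz => n; case: (eP n).
- by case: (eP n).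
- by apply: poly_in_leq hsz => n; case: (eP n).
- by case: (eP n).
Qed.

End BitSums.

(** * Branching programs as linear straight-line programs *)

Section Walks.
Variables (R : comNzRingType) (T : finType).
Implicit Types (B : T -> T -> R) (u v sink : T).

(* The weight of the walks of length [k] from [u] to [sink]. *)
Fixpoint walk B sink (k : nat) (u : T) : R :=
  if k is k'.+1 then \sum_v B u v * walk B sink k' v else (u == sink)%:R.

(** Giving weight 0 to non-edges turns the sum over paths into an entry of a matrix power. *)
Lemma walk_tuple (e : rel T) (lab : T -> T -> R) sink k u :
  \sum_(p : k.-tuple T | path e u p && (last u p == sink))
    \prod_(l <- pairmap lab u p) l =
  walk (fun x y => if e x y then lab x y else 0) sink k u.
Proof.
elim: k u => [|k IHk] u.
  rewrite big_mkcond (bigD1 [tuple]) //= big_nil big1 ?addr0.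
    by case: eqP.
  by move=> p /eqP /(_ (tuple0 p)).
rewrite (reindex (fun vp : T * k.-tuple T => cons_tuple vp.1 vp.2)) /=; last first.
  exists (fun p : k.+1.-tuple T => (thead p, behead_tuple p)) => [[v p]|p] _ /=.
    by congr (_, _); apply: val_inj.
  by rewrite [p in RHS]tuple_eta; apply: val_inj.
rewrite big_mkcond /=; transitivity (\sum_v \sum_(p : k.-tuple T)
    if [&& e u v, path e v p & last v p == sink]
    then lab u v * \prod_(l <- pairmap lab v p) l else 0).
  rewrite pair_big /=; apply: eq_bigr => -[v p] _ /=.
  by rewrite big_cons -andbA.
apply: eq_bigr => v _; case: (e u v) => /=.
  by rewrite -IHk -big_mkcond big_distrr.
by rewrite mul0r big1.
Qed.

End Walks.

Lemma walk_enum_rank (R : comNzRingType) (T : finType) (B : T -> T -> R) sink k u :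
  walk (fun x y : 'I_#|T| => B (enum_val x) (enum_val y)) (enum_rank sink) k (enum_rank u)
  = walk B sink k u.
Proof.
elim: k u => [|k IHk] u /=.
  by rewrite (inj_eq enum_rank_inj).
rewrite (reindex (@enum_rank T)) /=; last exact/onW_bij/enum_rank_bij.
by apply: eq_bigr => v _; rewrite !enum_rankK IHk.
Qed.

Section LinearPrograms.
Variable K : fieldType.

Section Fixed.
Variable n : nat.
Implicit Types (vs ws : seq {mpoly K[n]}) (p q : {mpoly K[n]}).

(** This is the linear counterpart of [slp_step]: in every product one factor is affine and the
    other an earlier value, as along the edges of a branching program. *)
Definition lslp_step vs p : Prop :=
  exists2 ls : seq ({mpoly K[n]} * {mpoly K[n]}),
    all (fun x => (msize x.1 <= 2)%N && (x.2 \in vs)) ls &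
    p = \sum_(x <- ls) x.1 * x.2.

Inductive lslp : seq {mpoly K[n]} -> Prop :=
| lslp_one : lslp [:: 1]
| lslp_cons vs p of lslp vs & lslp_step vs p : lslp (p :: vs).

Lemma mem1_lslp vs : lslp vs -> 1 \in vs.
Proof. by elim=> [|{}vs p _ IH _]; rewrite inE ?IH ?orbT. Qed.

Lemma lslp_step_sub vs ws p : {subset vs <= ws} -> lslp_step vs p -> lslp_step ws p.
Proof.
move=> sub [ls /allP h E]; exists ls => //; apply/allP => x /h /andP [-> /sub] //.
Qed.

Lemma lslp_step_id vs p : p \in vs -> lslp_step vs p.
Proof.
move=> hp; exists [:: (1, p)]; first by rewrite /= msize1 hp.
by rewrite big_seq1 mul1r.
Qed.

Lemma lslp_cat vs ws : lslp vs -> lslp ws -> lslp (vs ++ ws).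
Proof.
move=> hvs hws; elim: hvs => [|{}vs p _ IH st] /=.
  by apply: lslp_cons => //; apply/lslp_step_id/mem1_lslp.
apply: lslp_cons => //.
by apply: lslp_step_sub st => x; rewrite mem_cat => ->.
Qed.

(** Serial composition: the first program is restarted from [q] in place of 1, and its steps, being
    linear in the earlier values, commute with multiplication by [q]. *)
Lemma lslp_mulr vs ws q : lslp vs -> lslp ws -> q \in ws ->
  lslp ([seq v * q | v <- vs] ++ ws).
Proof.
move=> hvs hws qws; elim: hvs => [|{}vs p _ IH [ls /allP h ->]] /=.
  by apply: lslp_cons => //; apply: lslp_step_id; rewrite mul1r.
apply: lslp_cons => //; exists [seq (x.1, x.2 * q) | x <- ls].
  apply/allP => y /mapP [x /h /andP [hx1 hx2] ->] /=; rewrite hx1 mem_cat.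
  by rewrite (map_f (fun v => v * q) hx2).
by rewrite big_map mulr_suml; apply: eq_bigr => x _; rewrite mulrA.
Qed.

Definition lslp_comp p s : Prop :=
  exists vs, [/\ lslp vs, p \in vs & (size vs <= s)%N].

(** The total weight of the paths from a vertex to the sink is a combination of those of its
    successors, with the edge labels as affine coefficients. The extra unit of size is the initial
    value 1. *)
Lemma lslp_of_abp (A : abp K n) : abp_wf A -> lslp_comp (abp_poly A) (abp_size A).+1.
Proof.
case=> lay_le lay_src lay_snk edgeP.
pose B (u v : 'I_(abp_size A)) := if abp_edge u v then abp_label u v else 0.
pose val u := walk B (abp_sink A) (abp_depth A - abp_layer u) u.
(* Induction over sets closed under successors: edges raise the layer, so a vertex of least layer in
   [U] is no successor within [U] and can be removed, to be computed last. *)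
suff H (U : {set 'I_(abp_size A)}) :
    (forall u v, u \in U -> abp_edge u v -> v \in U) ->
    exists vs, [/\ lslp vs, forall u, u \in U -> val u \in vs & (size vs <= #|U|.+1)%N].
  have [|vs [h1 h2 h3]] := H setT; first by move=> u v; rewrite !inE.
  exists vs; split=> //; last by rewrite cardsT card_ord in h3.
  have := h2 (abp_source A) (in_setT _).
  rewrite /val (lay_src (abp_source A)).2 // subn0 /abp_poly.
  by rewrite (walk_tuple (@abp_edge K n A) (@abp_label K n A)).
have [k] := ubnP #|U|; elim: k U => // k IHk U ltk closedU.
case: (set_0Vmem U) => [->|[u0 hu0]].
  by exists [:: 1]; split=> //; [exact: lslp_one | move=> u; rewrite inE].
have [u hu' minu] := arg_minnP (fun u => abp_layer u) hu0.
have hu : u \in U by exact: hu'.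
have [||vs [h1 h2 h3]] := IHk (U :\ u).
- by move: ltk; rewrite (cardsD1 u U) hu.
- move=> x y; rewrite !inE => /andP [xu xU] exy; rewrite (closedU _ _ xU exy) andbT.
  apply/eqP => yu; have [ly _] := edgeP _ _ exy; have := minu x xU.
  by rewrite -yu ly ltnn.
exists (val u :: vs); split.
- apply: lslp_cons => //.
  have := lay_le u; rewrite leq_eqVlt => /orP [/eqP lu|lu].
    have us := (lay_snk u).1 lu.
    rewrite /val lu subnn /= us eqxx; apply/lslp_step_id/mem1_lslp; exact: h1.
  exists [seq (abp_label u v, val v) | v <- enum 'I_(abp_size A) & abp_edge u v].
    apply/allP => x /mapP [v]; rewrite mem_filter => /andP [euv _] -> /=.
    have [lv ->] := edgeP _ _ euv; rewrite /= h2 // !inE (closedU _ _ hu euv) andbT.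
    by apply/eqP => vu; move: lv; rewrite vu => /eqP; rewrite -[X in X == _]addn0 -addn1 eqn_add2l.
  rewrite big_map big_filter big_mkcond /= /val -(subSS (abp_layer u)) subSn //=.
  rewrite big_enum /=; apply: eq_bigr => v _; rewrite /B.
  case: ifP => [euv|_]; last by rewrite mul0r.
  by have [-> _] := edgeP _ _ euv.
- move=> x hx; rewrite inE; case: (eqVneq x u) => [->|xu]; first by rewrite eqxx.
  by rewrite h2 ?orbT // !inE xu.
by rewrite /= ltnS (leq_trans h3) // (cardsD1 u U) hu.
Qed.

(** Values may repeat in [vs], so an operand is identified with its first position, and the affine
    factors of all operands at the same position are added up. *)
Lemma lslp_coefs vs : lslp vs -> exists l : nat -> nat -> {mpoly K[n]},
  [/\ forall j i, (msize (l j i) <= 2)%N, (rev vs)`_0 = 1 &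
   forall j, (0 < j < size vs)%N -> (rev vs)`_j = \sum_(i < j) l j i * (rev vs)`_i].
Proof.
elim=> [|{}vs p _ [l [l2 E0 El]] [ls /allP h Ep]].
  by exists (fun _ _ => 0); split=> [j i||[|j]] //; rewrite msize0.
pose lp i : {mpoly K[n]} := \sum_(x <- ls | index x.2 (rev vs) == i) x.1.
exists (fun j => if j == size vs then lp else l j); split.
- move=> j i; case: ifP => // _; rewrite /lp big_seq_cond.
  apply: (big_ind (fun q : {mpoly K[n]} => msize q <= 2)%N); first by rewrite msize0.
    by move=> a b ha hb; apply: leq_trans (msizeD_le _ _) _; rewrite geq_max ha.
  by move=> x /andP [/h /andP []].
- rewrite rev_cons nth_rcons size_rev; case: vs E0 {El h Ep lp} => //=.
  by rewrite /rev /= => /eqP; rewrite eq_sym oner_eq0.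
move=> j /andP [j0]; rewrite /= ltnS leq_eqVlt rev_cons nth_rcons size_rev.
have nthE i : (i < size vs)%N -> (rcons (rev vs) p)`_i = (rev vs)`_i.
  by move=> hi; rewrite nth_rcons size_rev hi.
case/orP=> [/eqP ->|hj]; last first.
  rewrite hj ltn_eqF // El ?j0 //; apply: eq_bigr => i _.
  by rewrite nthE // (ltn_trans _ hj).
rewrite ltnn eqxx [LHS]Ep.
under [RHS]eq_bigr => i _ do rewrite nthE // /lp mulr_suml big_mkcond.
rewrite exchange_big /= !big_seq; apply: eq_bigr => x /h /andP [_ hx].
have lt_x : (index x.2 (rev vs) < size vs)%N by rewrite -(size_rev vs) index_mem mem_rev.
rewrite (bigD1 (Ordinal lt_x)) //= eqxx nth_index ?mem_rev // big1 ?addr0 //.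
by move=> i; rewrite -val_eqE /= eq_sym => /negPf ->.
Qed.

Section ToABP.
Variables (N : nat) (l : nat -> nat -> {mpoly K[n]}) (r : nat -> {mpoly K[n]}).
Hypothesis l2 : forall j i, (msize (l j i) <= 2)%N.
Hypothesis r0 : r 0%N = 1.
Hypothesis rE : forall j, (0 < j < N.+1)%N -> r j = \sum_(i < j) l j i * r i.

(* The loop of weight 1 at the index 0 makes all walks equally long. *)
Let M (j i : 'I_N.+1) : {mpoly K[n]} :=
  if (j == ord0) && (i == ord0) then 1 else if (i < j)%N then l j i else 0.

Let M2 j i : (msize (M j i) <= 2)%N.
Proof. by rewrite /M; case: ifP; rewrite ?msize1 //; case: ifP; rewrite ?msize0. Qed.

(** Outside the loop at 0 the index strictly decreases, so a walk from [j] to 0 makes at most [j]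
    proper steps and spends the others on the loop. *)
Lemma walk_lslp k (j : 'I_N.+1) : (j <= k)%N -> walk M ord0 k j = r j.
Proof.
elim: k j => [|k IHk] j /=.
  by rewrite leqn0 -[_ == 0%N]/(j == ord0) => /eqP ->; rewrite eqxx r0.
move=> jk; case: (posnP j) => [j0|j0].
  have -> : j = ord0 by apply: val_inj.
  rewrite (bigD1 ord0) //= IHk // /M eqxx mul1r big1 ?addr0 // => i /negPf i0.
  by rewrite i0 /= mul0r.
rewrite rE ?j0 ?ltn_ord //.
rewrite (big_ord_widen_cond N.+1 xpredT (fun i => l j i * r i)) ?(ltnW (ltn_ord j)) //.
rewrite [RHS]big_mkcond /=; apply: eq_bigr => i _; rewrite /M.
rewrite -[j == ord0]/(val j == 0%N) (gtn_eqF j0) /=; case: ifP => ij; last by rewrite mul0r.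
by rewrite IHk // -ltnS (leq_trans ij).
Qed.

Let vertex : finType := ('I_N.+1 * 'I_N.+1 + bool)%type.

Let layer (v : vertex) : nat :=
  match v with inl (k, _) => k.+1 | inr b => if b then N.+2 else 0%N end.

Variable j0 : 'I_N.+1.

Let index (v : vertex) : 'I_N.+1 :=
  match v with inl (_, i) => i | inr b => if b then ord0 else j0 end.

Definition lslp_abp : abp K n :=
  @ABP K n #|vertex| N.+2
    (fun u => layer (enum_val u))
    (fun u v => layer (enum_val v) == (layer (enum_val u)).+1)
    (fun u v => M (index (enum_val u)) (index (enum_val v)))
    (enum_rank (inr false : vertex)) (enum_rank (inr true : vertex)).

Lemma lslp_abp_wf : abp_wf lslp_abp.
Proof.
split=> [u|u|u|u v] /=.
- by case: (enum_val u) => [[k i]|[]] //=; apply: leqW; apply: ltn_ord.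
- split=> [|->]; last by rewrite enum_rankK.
  by rewrite -{2}(enum_valK u); case: (enum_val u) => [[k i]|[]].
- split=> [|->]; last by rewrite enum_rankK.
  rewrite -{2}(enum_valK u); case: (enum_val u) => [[k i]|[]] //= [E].
  by have := ltn_ord k; rewrite E ltnn.
by move=> /eqP ->.
Qed.

Lemma lslp_abp_poly : abp_poly lslp_abp = r j0.
Proof.
pose B (x y : vertex) := if layer y == (layer x).+1 then M (index x) (index y) else 0.
rewrite /abp_poly (walk_tuple (@abp_edge K n lslp_abp) (@abp_label K n lslp_abp)).
transitivity (walk B (inr true) N.+2 (inr false)); first exact: (walk_enum_rank B).
(* Here [k] is the number of steps left. The case of one step is separate: the last layer holds only
   the sink, while [walk M] ranges over all indices, of which only 0 contributes. *)
have W k (x : vertex) : (layer x + k = N.+2)%N ->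
    walk B (inr true) k x = walk M ord0 k (index x).
  elim: k x => [|k IHk] x /=.
    by rewrite addn0; case: x => [[a i]|[]] //= [E]; have := ltn_ord a; rewrite E ltnn.
  rewrite addnS => -[lx]; rewrite -[RHS]add0r.
  case: k IHk lx => [|k] IHk lx.
    rewrite addn0 in lx; rewrite add0r.
    rewrite (bigD1 (inr true)) //= big1 => [|y ny].
      rewrite addr0 mulr1 /B /= lx eqxx (bigD1 ord0) //= mulr1 big1 ?addr0 //.
      by move=> i /negPf -> ; rewrite mulr0.
    by rewrite /= (negPf ny) mulr0.
  have lk : (layer x < N.+1)%N by lia.
  pose k0 := Ordinal lk.
  rewrite add0r [RHS](eq_bigr (fun i => B x (inl (k0, i)) * walk B (inr true) k.+1 (inl (k0, i)))).
    rewrite big_sumType /= [X in _ + X]big1 ?addr0; last first.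
      move=> [] _; rewrite /B /=; last by rewrite mul0r.
      by rewrite gtn_eqF ?mul0r //= ltnS.
    transitivity (\sum_(a < N.+1) \sum_(i < N.+1)
        B x (inl (a, i)) * walk B (inr true) k.+1 (inl (a, i))).
      by rewrite pair_big; apply: eq_bigr => -[].
    rewrite (bigD1 k0) //= [X in _ + X]big1 ?addr0 // => a ak0.
    apply: big1 => i _; rewrite /B /= eqSS.
    by case: eqP => [E|_]; [case/eqP: ak0; apply: val_inj | rewrite mul0r].
  move=> i _; rewrite IHk /=; last by lia.
  by rewrite /B /= eqxx.
rewrite W //; apply: walk_lslp.
by apply: leq_trans (ltnW (ltn_ord j0)) _.
Qed.

End ToABP.

Lemma abp_of_lslp p s : lslp_comp p s -> exists A : abp K n,
  [/\ abp_wf A, (abp_size A <= s * s + 2)%N & abp_poly A = p].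
Proof.
case=> vs [hvs pvs svs]; have [l [l2 r0 rE]] := lslp_coefs hvs.
have lt_p : (index p (rev vs) < size vs)%N by rewrite -(size_rev vs) index_mem mem_rev.
have [N EN] : exists N, size vs = N.+1 by case: (vs) lt_p => // x vs' _; exists (size vs').
rewrite EN in rE lt_p.
exists (lslp_abp l (Ordinal lt_p)); split.
- exact: lslp_abp_wf.
- by rewrite /= card_sum card_prod card_bool !card_ord leq_add2r leq_mul // -EN.
by rewrite (lslp_abp_poly r0 rE) /= nth_index // mem_rev.
Qed.

End Fixed.

Lemma lslp_robust : robust_measure lslp_comp 2.
Proof.
split=> [n p s t st [vs [h1 h2 h3]]|n c
  |n p q s t [vs [h1 h2 h3]] [ws [k1 k2 k3]]|n p q s t [vs [h1 h2 h3]] [ws [k1 k2 k3]]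
  |n p s a b [vs [h1 h2 h3]]].
- by exists vs; split=> //; apply: leq_trans st.
- exists [:: c%:MP; 1]; rewrite !inE eqxx; split=> //.
  apply: lslp_cons; first exact: lslp_one.
  exists [:: (c%:MP, 1)]; last by rewrite big_seq1 mulr1.
  by rewrite /= !inE eqxx msizeC andbT; case: (c == 0).
- exists (p + q :: vs ++ ws); split.
  + apply: lslp_cons; first exact: lslp_cat.
    exists [:: (1, p); (1, q)]; last by rewrite big_cons big_seq1 !mul1r.
    by rewrite /= !msize1 !mem_cat h2 k2 orbT.
  + by rewrite inE eqxx.
  by rewrite /= size_cat; move: h3 k3; move: (size vs) (size ws); lia.
- exists ([seq v * q | v <- vs] ++ ws); split.
  + exact: lslp_mulr.
  + by rewrite mem_cat (map_f (fun v => v * q) h2).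
  by rewrite size_cat size_map; move: h3 k3; move: (size vs) (size ws); lia.
exists [seq affine_subst a b v | v <- vs]; split.
- elim: h1 {h2 h3} => [|us q _ IH [ls /allP h ->]] /=.
    by rewrite rmorph1; apply: lslp_one.
  apply: lslp_cons => //; exists [seq (affine_subst a b x.1, affine_subst a b x.2) | x <- ls].
    apply/allP => y /mapP [x /h /andP [hx1 hx2] ->] /=.
    by rewrite (leq_trans (msize_affine_subst _ _ _)) //= map_f.
  rewrite big_map (raddf_sum (affine_subst a b)); apply: eq_bigr => x _.
  by rewrite /= -(rmorphM (affine_subst a b)).
- exact: map_f.
by rewrite size_map; move: h3; move: (size vs); lia.
Qed.

Lemma VBP_measured s : measured (VBP s) s lslp_comp.
Proof.
move=> f; split=> -[df].
  case=> A [wf sA fE]; split=> //; exists (fun n => (abp_size (A n)).+1) => [|n].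
    exact: poly_inS.
  by rewrite -fE; apply: lslp_of_abp.
case=> sz hsz comp_f; split=> //.
have ex n := abp_of_lslp (comp_f n).
pose A n := proj1_sig (constructive_indefinite_description _ (ex n)).
have AP n := proj2_sig (constructive_indefinite_description _ (ex n)).
exists A; split=> [n||n]; try by case: (AP n).
apply: (poly_in_leq (u := fun n => sz n * sz n + 2)%N) => [n|].
  by case: (AP n).
apply: poly_inD; [exact: poly_inM | exact: poly_in_const].
Qed.

End LinearPrograms.

(** Adding exponential sums divides by powers of 2, here over [F(eps)]. *)
Lemma ratfun_two_neq0 (F : fieldType) :
  [pchar F] =i pred0 -> (2%:R : ratfun F) != 0.
Proof.
move=> charF; rewrite -(rmorph_nat (@tofrac {poly F})) tofrac_eq0.
by rewrite -polyC_natr polyC_eq0 natr_neq0.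
Qed.

Theorem theorem5p3 (F : closedFieldType) (charF : [pchar F]%R =i pred0) :
  [/\ @closed_under_factors F (@approx_closure (VF n_pow_log_n) F),
      @closed_under_factors F (@approx_closure (VBP n_pow_log_n) F)
    & @closed_under_factors F (@approx_closure (VNP n_pow_log_n) F)].
Proof.
have s_id := poly_in_n_pow_log_n; split.
- exact: (closed_under_factors_transfer charF s_id (formula_robust _) (@VF_measured _ _)).
- exact: (closed_under_factors_transfer charF s_id (lslp_robust _) (@VBP_measured _ _)).
- exact: (closed_under_factors_transfer charF s_id
    (bitsum_robust (ratfun_two_neq0 charF)) (@VNP_measured _ _)).
Qed.
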